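(* Let $n > 1$. The class $\mathrm{FP}_n\text{-flat}$ of $\mathrm{FP}_n$-flat left $R$-modules is the left half of a perfect cotorsion pair $(\mathrm{FP}_n\text{-flat}, (\mathrm{FP}_n\text{-flat})^{\perp})$ in the category of left $R$-modules.
   Context: $R$ is an associative ring with unit. For $n \ge 0$, a (left or right) $R$-module is finitely $n$-presented if there is an exact sequence $F_n \to \cdots \to F_0 \to M \to 0$ with every $F_i$ finitely generated free; $\mathrm{FP}_n$ is the class of such modules. A left $R$-module $M$ is $\mathrm{FP}_n$-flat if $\mathrm{Tor}_1^R(F,M)=0$ for every right $R$-module $F\in\mathrm{FP}_n$. For a class $\mathcal C$, $\mathcal C^\perp=\{X:\mathrm{Ext}^1_R(C,X)=0\ \forall C\in\mathcal C\}$, ${}^\perp\mathcal C=\{X:\mathrm{Ext}^1_R(X,C)=0\ \forall C\in\mathcal C\}$; $(\mathcal A,\mathcal B)$ is a cotorsion pair if $\mathcal A^\perp=\mathcal B$ and ${}^\perp\mathcal B=\mathcal A$. A map $f:C\to M$ with $C\in\mathcal C$ is a $\mathcal C$-cover if $\mathrm{Hom}_R(C',C)\to\mathrm{Hom}_R(C',M)$ is surjective for all $C'\in\mathcal C$ and every $g$ with $f\circ g=f$ is an automorphism of $C$; dually for $\mathcal C$-envelopes. $\mathcal C$ is covering (enveloping) if every module has a $\mathcal C$-cover (envelope). A cotorsion pair $(\mathcal A,\mathcal B)$ is perfect if $\mathcal A$ is covering and $\mathcal B$ is enveloping. *)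

(* Defs.v *)
From HB Require Import structures.
From mathcomp Require Import all_boot all_order all_algebra.
Set Implicit Arguments. Unset Strict Implicit. Unset Printing Implicit Defensive.
Import GRing.Theory.
Local Open Scope ring_scope.

(* Throughout: R is an associative ring with unit (possibly the zero ring).
   Left R-modules are [lmodType R]; right R-modules are left modules over the
   converse ring, i.e. [lmodType R^c].  The category of left R-modules is the
   category whose objects are [lmodType R] and whose morphisms are R-linear maps. *)

Section Defs.
Variable R : pzRingType.

Definition mclass := lmodType R -> Prop.

(* ---------- Ext^1 (Yoneda): Ext^1_R(A,B) = 0 iff every extension
   0 -> B -> E -> A -> 0 splits. *)
Definition ext1_zero (A B : lmodType R) : Prop :=
  forall (E : lmodType R) (i : {linear B -> E}) (p : {linear E -> A}),
    injective i -> (forall a, exists e, p e = a) ->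
    (forall e, p e = 0 <-> exists b, i b = e) ->
    exists s : {linear A -> E}, forall a, p (s a) = a.

Definition perp_right (C : mclass) : mclass :=
  fun X => forall Y, C Y -> ext1_zero Y X.
Definition perp_left (C : mclass) : mclass :=
  fun X => forall Y, C Y -> ext1_zero X Y.

Definition cotorsion_pair (A B : mclass) : Prop :=
  (forall X, B X <-> perp_right A X) /\ (forall X, A X <-> perp_left B X).

Definition is_cover (C : mclass) (M X : lmodType R) (f : {linear X -> M}) :=
  [/\ C X,
      (forall (Y : lmodType R), C Y -> forall g : {linear Y -> M},
          exists h : {linear Y -> X}, forall y, f (h y) = g y)
    & (forall g : {linear X -> X}, (forall x, f (g x) = f x) -> bijective g)].

Definition is_envelope (C : mclass) (M X : lmodType R) (f : {linear M -> X}) :=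
  [/\ C X,
      (forall (Y : lmodType R), C Y -> forall g : {linear M -> Y},
          exists h : {linear X -> Y}, forall m, h (f m) = g m)
    & (forall g : {linear X -> X}, (forall m, g (f m) = f m) -> bijective g)].

Definition covering (C : mclass) :=
  forall M : lmodType R, exists (X : lmodType R) (f : {linear X -> M}), is_cover C f.
Definition enveloping (C : mclass) :=
  forall M : lmodType R, exists (X : lmodType R) (f : {linear M -> X}), is_envelope C f.

Definition perfect_cotorsion_pair (A B : mclass) :=
  [/\ cotorsion_pair A B, covering A & enveloping B].

(* ---------- finitely n-presented right modules.
   Finitely generated free right modules are 'rV[R^c]_k (= R^k with right
   R-action).  FP_n: there are free f.g. F_0,...,F_n and an exact sequence
   F_n --d_(n-1)--> ... --d_0--> F_0 --e--> F --> 0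
   (exact at F, at F_0 if n>0, and at F_(i+1) for i+1 < n). *)
Definition FPn (n : nat) (F : lmodType R^c) : Prop :=
  exists (k : nat -> nat)
         (d : forall i, {linear 'rV[R^c]_(k i.+1) -> 'rV[R^c]_(k i)})
         (e : {linear 'rV[R^c]_(k 0%N) -> F}),
    [/\ (forall y, exists x, e x = y),
        (0 < n)%N -> (forall x, e x = 0 <-> exists y, d 0%N y = x)
      & forall i, (i.+1 < n)%N ->
          forall x, d i x = 0 <-> exists y, d i.+1 y = x].

(* f (x) M for a right-linear map f : R^a -> R^b between f.g. free right modules,
   under the canonical identification R^a (x)_R M = M^a (e_i (x) m <-> m in slot i).
   If f(e_i) = sum_j e_j r_ji then (f (x) M)(x)_j = sum_i r_ji x_i. *)
Definition tens_free (a b : nat) (f : {linear 'rV[R^c]_a -> 'rV[R^c]_b})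
    (M : lmodType R) (x : 'I_a -> M) : 'I_b -> M :=
  fun j => \sum_(i < a) ((f (delta_mx 0 i) 0 j : R^c) : R) *: x i.

(* Tor_1^R(F, M) = 0, computed from a finitely generated free (partial)
   resolution F_2 -> F_1 -> F_0 -> F -> 0 (Tor_1 only depends on this part):
   it is the homology at F_1 (x) M of F_2 (x) M -> F_1 (x) M -> F_0 (x) M.
   We require vanishing for every such resolution (all give the same Tor_1). *)
Definition tor1_zero (F : lmodType R^c) (M : lmodType R) : Prop :=
  forall (k0 k1 k2 : nat) (e : {linear 'rV[R^c]_k0 -> F})
         (d0 : {linear 'rV[R^c]_k1 -> 'rV[R^c]_k0})
         (d1 : {linear 'rV[R^c]_k2 -> 'rV[R^c]_k1}),
    (forall y, exists x, e x = y) ->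
    (forall x, e x = 0 <-> exists y, d0 y = x) ->
    (forall x, d0 x = 0 <-> exists y, d1 y = x) ->
    forall x : 'I_k1 -> M, (forall j, tens_free d0 x j = 0) ->
      exists y : 'I_k2 -> M, forall j, tens_free d1 y j = x j.

Definition FPn_flat (n : nat) : mclass :=
  fun M => forall F : lmodType R^c, FPn n F -> tor1_zero F M.

End Defs.

(* Main.v *)
From HB Require Import structures.
Require Import Defs.
From mathcomp Require Import all_boot all_order all_algebra.
From mathcomp Require Import boolp classical_sets.

(** FP_n-flatness of [X] says that certain complexes [X^k2 -> X^k1 -> X^k0] given by fixed
    matrices over [R] are exact.  For modules [N] and [M], consider the category of diagrams
    [N -> X -> M] with zero composite, whose first map is injective with FP_n-flat cokernel.
    A weakly terminal object all of whose endomorphisms are automorphisms is a flat cover of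
    [M] when [N = 0], and an envelope of [N] in the orthogonal class when [M = 0]; by
    Wakamatsu's lemma the covers also show that flat modules are exactly the left orthogonal
    of that class.

    To find such an object: (1) every object maps to one that is a quotient of a fixed set of
    trees, because in a larger object two copies of a small configuration differ by a nonzero
    submodule that can be factored out; (2) by Zorn's lemma every object then maps to a rigid
    one, i.e. one all of whose outgoing morphisms are injective; (3) by Zorn's lemma again
    there is a rigid object whose morphisms to rigid objects are all bijective, and amalgamating
    it with any other object over [N] shows that it is weakly terminal. *)

Set Implicit Arguments. Unset Strict Implicit. Unset Printing Implicit Defensive.
Import GRing.Theory.
Local Open Scope ring_scope.

(** * Zorn's lemma above a given set *)

Definition surj (A B : Type) (f : A -> B) := forall b, exists a, f a = b.

Lemma Zorn_nonempty (T : Type) (P : set (set T)) (A0 : set T) :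
  P A0 ->
  (forall F : set (set T), F A0 -> (forall A, F A -> P A) ->
     (forall A B, F A -> F B -> (A `<=` B \/ B `<=` A)%classic) ->
     P (fun x => exists2 A, F A & A x)) ->
  exists A, [/\ P A, (A0 `<=` A)%classic
    & forall B, P B -> (A `<=` B)%classic -> (B `<=` A)%classic].
Proof.
move=> PA0 Pun.
pose Q := [set A : set T | A = set0 \/ P A /\ (A0 `<=` A)%classic]%classic.
have [|A [QA maxA]] := @Zorn_bigcup T Q.
  move=> F FQ Ftot.
  case: (pselect (exists2 A, F A & P A /\ (A0 `<=` A)%classic)) => [[A FA [PA A0A]]|nF]; last first.
    left; apply/seteqP; split=> // x [A FA Ax]; case: (FQ _ FA) => [Ae|PA].
      by rewrite Ae in Ax.
    by case: nF; exists A.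
  right; split; last by move=> x A0x; exists A => //; apply: A0A.
  pose F' := [set B : set T | F B /\ P B /\ (A0 `<=` B)%classic \/ B = A0]%classic.
  have := Pun F' (or_intror erefl).
  have -> : (fun x => exists2 B, F' B & B x) = (\bigcup_(X in F) X)%classic.
    apply/seteqP; split=> x.
      move=> [B [[FB _]|->] Bx]; first by exists B.
      by exists A => //; apply: A0A.
    move=> [B FB Bx]; case: (FQ _ FB) => [B0|PB]; first by rewrite B0 in Bx.
    by exists B => //; left.
  apply.
    by move=> B [[_ []]//|->].
  move=> B C [[FB [_ A0B]]|->] [[FC [_ A0C]]|->].
  - by case: (Ftot _ _ FB FC); [left|right].
  - by right.
  - by left.
  - by left.
have PA : P A /\ (A0 `<=` A)%classic.
  case: QA => // A_0.
  case: (pselect (A0 = set0)) => [A00|A0n].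
    by rewrite A_0 -A00; split.
  case: (maxA A0); last by right; split.
  by rewrite A_0; split=> // A00; apply: A0n; apply/seteqP; split.
exists A; split; [by case: PA|by case: PA|].
move=> B PB AB; apply: contrapT => nBA; apply: (maxA B); first by split.
by right; split=> //; case: PA => _ A0A; apply: subset_trans AB.
Qed.

(** * Modules, submodules and quotients *)

Section Modules.
Variable R : pzRingType.
Implicit Types N K Q X Y W : lmodType R.

(** Functionality forces whatever function choice returns to be linear; most linear maps below are
    built from a relation in this way. *)
Lemma linear_of_rel X Y (f : X -> Y -> Prop) :
  (forall x, exists y, f x y) ->
  (forall x y y', f x y -> f x y' -> y = y') ->
  (forall a x x' y y', f x y -> f x' y' -> f (a *: x + x') (a *: y + y')) ->
  exists g : {linear X -> Y}, forall x, f x (g x).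
Proof.
move=> ftot ffun flin; have [g fg] := choice ftot.
have glin : linear g by move=> a x y; apply: ffun (fg _) _; apply: flin.
pose gM := GRing.isLinear.Build _ _ _ _ g glin.
pose gL : {linear X -> Y} := HB.pack g gM.
by exists gL.
Qed.

Lemma linear_factor X Y Q (q : {linear X -> Q}) (f : {linear X -> Y}) :
  surj q -> (forall x, q x = 0 -> f x = 0) ->
  exists h : {linear Q -> Y}, forall x, h (q x) = f x.
Proof.
move=> qs kf.
have fE x x' : q x = q x' -> f x = f x'.
  by move=> e; apply/eqP; rewrite -subr_eq0 -linearB kf // linearB e subrr.
have [||a u u' v v'|h hP] := @linear_of_rel Q Y (fun u v => exists2 x, q x = u & f x = v).
- by move=> u; have [x <-] := qs u; exists (f x), x.
- by move=> u v v' [x <- <-] [x' /esym/fE-> <-].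
- by move=> [x <- <-] [x' <- <-]; exists (a *: x + x'); rewrite !linearP.
exists h => x; have [x' /fE-> ->] // := hP (q x).
Qed.

Lemma linear_bij_inv X Y (f : {linear X -> Y}) : bijective f ->
  exists g : {linear Y -> X}, cancel f g /\ cancel g f.
Proof.
move=> [g fK gK].
have [||a u u' v v' <- <-|h hP] := @linear_of_rel Y X (fun y x => f x = y).
- by move=> y; exists (g y).
- by move=> y x x' <- /(can_inj fK).
- by rewrite linearP.
by exists h; split=> // x; apply: (can_inj fK).
Qed.

(* A module presented as a quotient of a subset of [pcar]: [prel] is a partial
   equivalence relation, whose domain is the subset. *)
Record premodule := PreModule {
  pcar : Type;
  prel : pcar -> pcar -> Prop;
  pzero : pcar;
  padd : pcar -> pcar -> pcar;
  pscale : R -> pcar -> pcar;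
  prel_sym : forall x y, prel x y -> prel y x;
  prel_trans : forall x y z, prel x y -> prel y z -> prel x z;
  prel0 : prel pzero pzero;
  prelD : forall x x' y y', prel x x' -> prel y y' -> prel (padd x y) (padd x' y');
  prelZ : forall a x x', prel x x' -> prel (pscale a x) (pscale a x');
  paddC : forall x y, prel x x -> prel y y -> prel (padd x y) (padd y x);
  paddA : forall x y z, prel x x -> prel y y -> prel z z ->
    prel (padd x (padd y z)) (padd (padd x y) z);
  padd0 : forall x, prel x x -> prel (padd pzero x) x;
  paddN : forall x, prel x x -> prel (padd (pscale (-1) x) x) pzero;
  pscaleA : forall a b x, prel x x -> prel (pscale a (pscale b x)) (pscale (a * b) x);
  pscale1 : forall x, prel x x -> prel (pscale 1 x) x;
  pscaleDr : forall a x y, prel x x -> prel y y ->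
    prel (pscale a (padd x y)) (padd (pscale a x) (pscale a y));
  pscaleDl : forall a b x, prel x x ->
    prel (pscale (a + b) x) (padd (pscale a x) (pscale b x)) }.

(** * Quotients by partial equivalence relations *)

Section PreModuleQuotient.
Variable A : premodule.

Definition pquot := {P : pcar A -> Prop | exists2 x, prel x x & P = prel x}.
Definition prepr (q : pquot) : pcar A := s2val (cid2 (svalP q)).

Lemma prepr_dom q : prel (prepr q) (prepr q).
Proof. exact: (s2valP (cid2 (svalP q))). Qed.
Lemma preprE q : sval q = prel (prepr q).
Proof. exact: (s2valP' (cid2 (svalP q))). Qed.

Lemma pclass_subproof (x : pcar A) : prel x x -> exists2 y, prel y y & prel x = prel y.
Proof. by exists x. Qed.
Definition pclass (x : pcar A) (hx : prel x x) : pquot :=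
  exist _ (prel x) (pclass_subproof hx).
(** Total on purpose: elements outside the domain go to the class of zero, so that no domain proof
    has to be carried along. *)
Definition pproj (x : pcar A) : pquot :=
  if pselect (prel x x) is left h then pclass h else pclass (prel0 A).

Lemma prelE (x y : pcar A) : prel x y -> prel x = prel y.
Proof.
move=> h; apply/predeqP => z; split; last exact: prel_trans.
by apply: prel_trans; apply: prel_sym.
Qed.

Lemma pquot_inj (q q' : pquot) : sval q = sval q' -> q = q'.
Proof.
by case: q q' => [P hP] [P' hP'] /= e; subst P'; congr exist; apply: Prop_irrelevance.
Qed.

Lemma pproj_eq (x y : pcar A) : prel x y -> pproj x = pproj y.
Proof.
move=> h; have hx := prel_trans h (prel_sym h); have hy := prel_trans (prel_sym h) h.
rewrite /pproj; case: pselect => // h1; case: pselect => // h2.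
by apply: pquot_inj; rewrite /=; apply: prelE.
Qed.

Lemma preprK q : pproj (prepr q) = q.
Proof.
apply: pquot_inj; rewrite /pproj; case: pselect => [h|[]]; last exact: prepr_dom.
by rewrite [RHS]preprE.
Qed.

Lemma pprojK (x : pcar A) : prel x x -> prel x (prepr (pproj x)).
Proof.
move=> h; have := preprE (pproj x); rewrite {1}/pproj; case: pselect => // h' /= e.
by rewrite e; apply: prepr_dom.
Qed.

HB.instance Definition _ := gen_eqMixin pquot.
HB.instance Definition _ := gen_choiceMixin pquot.

Definition qadd q q' := pproj (padd (prepr q) (prepr q')).
Definition qopp q := pproj (pscale (-1) (prepr q)).
Definition qscale a q := pproj (pscale a (prepr q)).

Lemma qaddE (x y : pcar A) : prel x x -> prel y y ->
  qadd (pproj x) (pproj y) = pproj (padd x y).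
Proof. by move=> hx hy; apply: pproj_eq; apply: prelD; apply: prel_sym; apply: pprojK. Qed.
Lemma qscaleE a (x : pcar A) : prel x x -> qscale a (pproj x) = pproj (pscale a x).
Proof. by move=> hx; apply: pproj_eq; apply: prelZ; apply: prel_sym; apply: pprojK. Qed.

Lemma pquotP (q : pquot) : exists2 x, prel x x & q = pproj x.
Proof. by exists (prepr q); [exact: prepr_dom|rewrite preprK]. Qed.

Lemma padd_dom (x y : pcar A) : prel x x -> prel y y -> prel (padd x y) (padd x y).
Proof. by move=> hx hy; apply: prelD. Qed.
Lemma pscale_dom a (x : pcar A) : prel x x -> prel (pscale a x) (pscale a x).
Proof. by move=> hx; apply: prelZ. Qed.
Local Hint Resolve padd_dom pscale_dom prel0 : core.

Lemma qaddA : associative qadd.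
Proof.
move=> u v w; have [x hx ->] := pquotP u; have [y hy ->] := pquotP v; have [z hz ->] := pquotP w.
by rewrite !qaddE //; auto; apply: pproj_eq; apply: paddA.
Qed.
Lemma qaddC : commutative qadd.
Proof.
move=> u v; have [x hx ->] := pquotP u; have [y hy ->] := pquotP v.
by rewrite !qaddE //; apply: pproj_eq; apply: paddC.
Qed.
Lemma qadd0 : left_id (pproj (pzero A)) qadd.
Proof.
move=> u; have [x hx ->] := pquotP u.
by rewrite !qaddE //; apply: pproj_eq; apply: padd0.
Qed.
Lemma qaddN : left_inverse (pproj (pzero A)) qopp qadd.
Proof.
move=> u; have [x hx ->] := pquotP u.
by rewrite -[qopp _]/(qscale _ _) qscaleE // !qaddE; auto; apply: pproj_eq; apply: paddN.
Qed.
HB.instance Definition _ := GRing.isZmodule.Build pquot qaddA qaddC qadd0 qaddN.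

Lemma qscaleA a b v : qscale a (qscale b v) = qscale (a * b) v.
Proof.
have [x hx ->] := pquotP v.
by rewrite !qscaleE; auto; apply: pproj_eq; apply: pscaleA.
Qed.
Lemma qscale1 : left_id 1 qscale.
Proof.
move=> u; have [x hx ->] := pquotP u.
by rewrite !qscaleE //; apply: pproj_eq; apply: pscale1.
Qed.
Lemma qscaleDr : right_distributive qscale +%R.
Proof.
move=> a u v; have [x hx ->] := pquotP u; have [y hy ->] := pquotP v.
have qaddrE := qaddE : forall x y, _ -> _ -> pproj x + pproj y = pproj (padd x y).
by rewrite qaddrE // !qscaleE ?qaddrE; auto; apply: pproj_eq; apply: pscaleDr.
Qed.
Lemma qscaleDl v : {morph qscale^~ v: a b / a + b}.
Proof.
move=> a b; have [x hx ->] := pquotP v.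
have qaddrE := qaddE : forall x y, _ -> _ -> pproj x + pproj y = pproj (padd x y).
by rewrite !qscaleE // !qaddrE; auto; apply: pproj_eq; apply: pscaleDl.
Qed.
HB.instance Definition _ :=
  GRing.Zmodule_isLmodule.Build R pquot qscaleA qscale1 qscaleDr qscaleDl.

End PreModuleQuotient.

Lemma premodule_realize (A : premodule) :
  exists (Q : lmodType R) (f : pcar A -> Q),
  [/\ forall q, exists2 x, prel x x & f x = q,
      forall x y, prel x x -> prel y y -> (f x = f y <-> prel x y),
      f (pzero A) = 0,
      forall x y, prel x x -> prel y y -> f (padd x y) = f x + f y
    & forall a x, prel x x -> f (pscale a x) = a *: f x].
Proof.
exists (pquot A), (@pproj A); split=> //.
- by move=> q; have [x hx ->] := pquotP q; exists x.
- move=> x y hx hy; split=> [e|]; last exact: pproj_eq.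
  apply: prel_trans (pprojK hx) _; rewrite e; exact/prel_sym/pprojK.
- by move=> x y hx hy; rewrite -qaddE.
- by move=> a x hx; rewrite -qscaleE.
Qed.

(** * Submodules, quotient modules and pushouts *)

Definition submod X (S : X -> Prop) :=
  S 0 /\ forall a x y, S x -> S y -> S (a *: x + y).

Lemma submodD X (S : X -> Prop) : submod S -> forall x y, S x -> S y -> S (x + y).
Proof. by move=> [_ h] x y Sx Sy; rewrite -[x]scale1r; apply: h. Qed.
Lemma submodZ X (S : X -> Prop) : submod S -> forall a x, S x -> S (a *: x).
Proof. by move=> [h0 h] a x Sx; rewrite -[_ *: _]addr0; apply: h. Qed.
Lemma submodN X (S : X -> Prop) : submod S -> forall x, S x -> S (- x).
Proof. by move=> hS x Sx; rewrite -scaleN1r; apply: submodZ. Qed.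
Lemma submodB X (S : X -> Prop) : submod S -> forall x y, S x -> S y -> S (x - y).
Proof. by move=> hS x y Sx Sy; apply: submodD => //; apply: submodN. Qed.

Definition im X Y (f : {linear X -> Y}) : Y -> Prop := fun y => exists x, f x = y.

Lemma submod_im X Y (f : {linear X -> Y}) : submod (im f).
Proof.
split=> [|a _ _ [x <-] [y <-]]; first by exists 0; rewrite linear0.
by exists (a *: x + y); rewrite linearP.
Qed.

Lemma quotient_module X (S : X -> Prop) : submod S ->
  exists (Q : lmodType R) (q : {linear X -> Q}), surj q /\ forall x, q x = 0 <-> S x.
Proof.
move=> hS; have [S0 _] := hS.
have Sref (x : X) : S (x - x) by rewrite subrr.
have Seq (x y : X) : x = y -> S (x - y) by move=> ->.
unshelve epose (A := @PreModule X (fun x y => S (x - y)) 0 +%R *:%R _ _ _ _ _ _ _ _ _ _ _ _ _).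
- by move=> x y /(submodN hS); rewrite opprB.
- by move=> x y z /(submodD hS) h /h; rewrite addrA subrK.
- exact: Sref.
- by move=> x x' y y' /(submodD hS) h /h; rewrite opprD addrACA.
- by move=> a x x' /(submodZ hS a); rewrite scalerBr.
- by move=> *; apply: Seq; rewrite addrC.
- by move=> *; apply: Seq; rewrite addrA.
- by move=> *; apply: Seq; rewrite add0r.
- by move=> *; apply: Seq; rewrite scaleN1r addNr.
- by move=> *; apply: Seq; rewrite scalerA.
- by move=> *; apply: Seq; rewrite scale1r.
- by move=> *; apply: Seq; rewrite scalerDr.
- by move=> *; apply: Seq; rewrite scalerDl.
have [Q [f [fs fE f0 fD fZ]]] := premodule_realize A.
have flin : linear (f : X -> Q).
  by move=> a x y; rewrite -fZ -?fD //; apply: Sref.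
pose fM := GRing.isLinear.Build _ _ _ _ (f : X -> Q) flin.
pose fL : {linear X -> Q} := HB.pack (f : X -> Q) fM.
exists Q, fL; split=> [q|x]; first by have [x _ <-] := fs q; exists x.
by rewrite -[0 in X in X <-> _]f0 (fE x 0 (Sref x) (Sref 0)) /= subr0.
Qed.

Lemma submodule_module X (S : X -> Prop) : submod S ->
  exists (K : lmodType R) (i : {linear K -> X}),
    injective i /\ forall x, S x <-> im i x.
Proof.
move=> hS; have [S0 _] := hS.
(* Equality restricted to [S]: nothing is identified, only the domain shrinks. *)
unshelve epose (A := @PreModule X (fun x y => x = y /\ S x) 0 +%R *:%R _ _ _ _ _ _ _ _ _ _ _ _ _).
- by move=> x y [->].
- by move=> x y z [-> _] [-> ?].
- by [].
- by move=> x x' y y' [-> ?] [-> ?]; split=> //; apply: submodD.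
- by move=> a x x' [-> ?]; split=> //; apply: submodZ.
- by move=> x y [_ ?] [_ ?]; rewrite addrC; split=> //; apply: submodD.
- by move=> x y z [_ ?] [_ ?] [_ ?]; rewrite addrA; split=> //; do ?apply: submodD.
- by move=> x [_ ?]; rewrite add0r.
- by move=> x [_ ?]; rewrite scaleN1r addNr.
- by move=> a b x [_ ?]; rewrite scalerA; split=> //; apply: submodZ.
- by move=> x [_ ?]; rewrite scale1r.
- by move=> a x y [_ ?] [_ ?]; rewrite scalerDr; split=> //; apply: submodD=> //; apply: submodZ.
- by move=> a b x [_ ?]; rewrite scalerDl; split=> //; apply: submodD=> //; apply: submodZ.
have [K [f [fs fE f0 fD fZ]]] := premodule_realize A.
have f_inj (x y : X) : S x -> S y -> f x = f y -> x = y.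
  by move=> Sx Sy e; case: (fE x y (conj erefl Sx) (conj erefl Sy)) => h _; case: (h e).
have [||a k k' x x' [Sx <-] [Sx' <-]|i iP] := @linear_of_rel K X (fun k x => S x /\ f x = k).
- by move=> k; have [x [_ Sx] <-] := fs k; exists x.
- by move=> k x x' [Sx <-] [Sx' e]; apply: f_inj.
- split; first by apply: (proj2 hS).
  have [aSx e] : S (a *: x) /\ f (a *: x) = a *: f x by split; [exact: submodZ|apply: fZ].
  by rewrite -e; apply: fD.
exists K, i; split=> [k k' e|x].
  by have [_ <-] := iP k; have [_ <-] := iP k'; rewrite e.
split=> [Sx|[k <-]]; last by case: (iP k).
by exists (f x); have [Sy /f_inj->] := iP (f x).
Qed.

(** [W] is the quotient of [Y * X] by the pairs [(- g n, j n)]. The description of the kernel is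
    what later makes [a] injective when [j] is. *)
Lemma pushout N X Y (j : {linear N -> X}) (g : {linear N -> Y}) :
  exists (W : lmodType R) (a : {linear Y -> W}) (b : {linear X -> W}),
  [/\ forall n, b (j n) = a (g n),
      forall w, exists y x, w = a y + b x,
      forall y x, a y + b x = 0 -> exists n, y = - g n /\ x = j n
    & forall (Z : lmodType R) (f : {linear Y -> Z}) (h : {linear X -> Z}),
        (forall n, h (j n) = f (g n)) ->
        exists u : {linear W -> Z}, (forall y, u (a y) = f y) /\ (forall x, u (b x) = h x)].
Proof.
pose S (u : (Y * X)%type) := exists n, u = (- g n, j n).
have hS : submod S.
  split; first by exists 0; rewrite (linear0 g) (linear0 j) oppr0.
  move=> c _ _ [n ->] [n' ->]; exists (c *: n + n').
  by rewrite (linearP g) (linearP j) opprD -scalerN.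
have [W [q [qs qk]]] := quotient_module hS.
have [||c y y' _ _ -> ->|a aP] := @linear_of_rel Y W (fun y w => w = q (y, 0)).
- by move=> y; exists (q (y, 0)).
- by move=> y w w' -> ->.
- by rewrite -linearP; congr (q _); apply: injective_projections; rewrite /= ?scaler0 ?addr0.
have [||c y y' _ _ -> ->|b bP] := @linear_of_rel X W (fun x w => w = q (0, x)).
- by move=> x; exists (q (0, x)).
- by move=> y w w' -> ->.
- by rewrite -linearP; congr (q _); apply: injective_projections; rewrite /= ?scaler0 ?addr0.
have abE y x : a y + b x = q (y, x).
  by rewrite aP bP -linearD; congr (q _); apply: injective_projections; rewrite /= ?addr0 ?add0r.
exists W, a, b; split.
- move=> n; have /eqP : a (- g n) + b (j n) = 0 by rewrite abE; apply/qk; exists n.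
  by rewrite linearN addrC subr_eq0 => /eqP.
- by move=> w; have [[y x] <-] := qs w; exists y, x; rewrite abE.
- by move=> y x; rewrite abE => /qk [n [-> ->]]; exists n.
- move=> Z f h fh.
  have [||c u u' z z' [[y x] [<- <-]] [[y' x'] [<- <-]]|k kP] :=
    @linear_of_rel (Y * X)%type Z (fun u z => exists v, v = u /\ f v.1 + h v.2 = z).
  - by move=> u; exists (f u.1 + h u.2), u.
  - by move=> u z z' [v [-> <-]] [v' [-> <-]].
  - exists (c *: (y, x) + (y', x')); split=> //=.
    by rewrite (linearP f) (linearP h) scalerDr addrACA.
  have kE y x : k (y, x) = f y + h x by have [v [-> <-]] := kP (y, x).
  have [|u uE] := linear_factor qs (f := k).
    by move=> [y x] /qk [n [-> ->]]; rewrite kE linearN fh addNr.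
  exists u; split=> [y|x]; first by rewrite aP uE kE linear0 addr0.
  by rewrite bP uE kE linear0 add0r.
Qed.

End Modules.

(** * Flatness relative to a submodule *)

Section Action.
Variable R : pzRingType.
Implicit Types X Y W : lmodType R.

Definition act X a b (r : 'I_b -> 'I_a -> R) (x : 'I_a -> X) (j : 'I_b) : X :=
  \sum_(i < a) r j i *: x i.

Lemma act_ext X a b (r : 'I_b -> 'I_a -> R) (x y : 'I_a -> X) j :
  x =1 y -> act r x j = act r y j.
Proof. by move=> e; apply: eq_bigr => i _; rewrite e. Qed.

Lemma actD X a b (r : 'I_b -> 'I_a -> R) (x y : 'I_a -> X) j :
  act r (fun i => x i + y i) j = act r x j + act r y j.
Proof. by rewrite /act -big_split; apply: eq_bigr => i _; rewrite scalerDr. Qed.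

Lemma actB X a b (r : 'I_b -> 'I_a -> R) (x y : 'I_a -> X) j :
  act r (fun i => x i - y i) j = act r x j - act r y j.
Proof. by rewrite /act -sumrB; apply: eq_bigr => i _; rewrite scalerBr. Qed.

Lemma act_linear X Y (f : {linear X -> Y}) a b (r : 'I_b -> 'I_a -> R) (x : 'I_a -> X) j :
  f (act r x j) = act r (fun i => f (x i)) j.
Proof. by rewrite /act linear_sum; apply: eq_bigr => i _; rewrite linearZ. Qed.

End Action.

Section RelativeFlatness.
Variable R : pzRingType.
Variable fam : forall k0 k1 k2, ('I_k0 -> 'I_k1 -> R) -> ('I_k1 -> 'I_k2 -> R) -> Prop.
Hypothesis fam_comp0 : forall k0 k1 k2 (r0 : 'I_k0 -> 'I_k1 -> R) (r1 : 'I_k1 -> 'I_k2 -> R),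
  fam r0 r1 -> forall j l, \sum_i r0 j i * r1 i l = 0.
Implicit Types X Y W : lmodType R.

(* [rflat X S] says that tensoring the resolutions in [fam] with [X / S] keeps them exact,
   without forming the quotient. *)
Definition rflat X (S : X -> Prop) :=
  forall k0 k1 k2 (r0 : 'I_k0 -> 'I_k1 -> R) (r1 : 'I_k1 -> 'I_k2 -> R), fam r0 r1 ->
  forall x, (forall j, S (act r0 x j)) -> exists y, forall i, S (x i - act r1 y i).

Lemma act_fam0 X k0 k1 k2 (r0 : 'I_k0 -> 'I_k1 -> R) (r1 : 'I_k1 -> 'I_k2 -> R) (y : 'I_k2 -> X) j :
  fam r0 r1 -> act r0 (act r1 y) j = 0.
Proof.
move=> h; rewrite /act.
under eq_bigr => i _ do rewrite scaler_sumr.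
rewrite exchange_big big1 //= => l _.
under eq_bigr => i _ do rewrite scalerA.
by rewrite -scaler_suml fam_comp0 // scale0r.
Qed.

(** Extensions of flat by flat are flat. A solution modulo the image of [j] leaves an error in that
    image; since [r0 r1 = 0], the error still satisfies the system modulo [S], and a second solution
    in [X] absorbs it. *)
Lemma rflat_ext X W (j : {linear X -> W}) (S : X -> Prop) :
  injective j -> rflat (im j) -> rflat S -> rflat (fun w => exists2 x, S x & j x = w).
Proof.
move=> jinj Wf Sf k0 k1 k2 r0 r1 fr x hx.
have [|y hy] := Wf _ _ _ _ _ fr x; first by move=> l; have [x' _ <-] := hx l; exists x'.
have [a ha] := choice hy.
have [l|b hb] := Sf _ _ _ _ _ fr a.
  have [x' Sx' e] := hx l; have -> // : act r0 a l = x'.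
  apply: jinj; rewrite e (act_linear j) (act_ext _ _ ha) actB.
  by rewrite act_fam0 ?subr0.
exists (fun i => y i + j (b i)) => i; exists (a i - act r1 b i) => //.
by rewrite linearB ha (act_linear j) actD opprD addrA.
Qed.

(** * The category of diagrams [N -> X -> M] *)

Variables N M : lmodType R.

Record obj := Obj {
  ob :> lmodType R;
  oi : {linear N -> ob};
  op : {linear ob -> M};
  oi_inj : injective oi;
  op_oi : forall n, op (oi n) = 0;
  ob_flat : rflat (im oi) }.

Definition mor (X Y : obj) (f : {linear X -> Y}) :=
  (forall n, f (oi X n) = oi Y n) /\ (forall x, op Y (f x) = op X x).

Lemma mor_comp (X Y Z : obj) (f : {linear X -> Y}) (g : {linear Y -> Z}) :
  mor f -> mor g -> mor (g \o f).
Proof. by move=> [fi fp] [gi gp]; split=> [n|x] /=; rewrite ?fi ?gi ?gp ?fp. Qed.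

(* The submodules that can be factored out inside the category. *)
Definition good (X : obj) (H : X -> Prop) :=
  [/\ submod H, forall n, H (oi X n) -> n = 0, forall x, H x -> op X x = 0
    & rflat (fun x => exists n, H (x - oi X n))].

(** The last condition of [good] says that [X / (H + N)], the cokernel of [N] in [X / H], is
    flat. *)
Lemma good_quotient (X : obj) (H : X -> Prop) : good H ->
  exists (Q : obj) (f : {linear X -> Q}), [/\ mor f, surj f & forall x, f x = 0 <-> H x].
Proof.
move=> [hH Hi Hp Hf]; have [Q [q [qs qk]]] := quotient_module hH.
have [p pE] := linear_factor qs (fun x e => Hp x (iffLR (qk x) e)).
have inji : injective (q \o oi X).
  move=> n n' /= /eqP; rewrite -subr_eq0 -!linearB => /eqP /qk /Hi /eqP.
  by rewrite subr_eq0 => /eqP.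
have pi0 n : p ((q \o oi X) n) = 0 by rewrite /= pE op_oi.
have imE x : im (q \o oi X) (q x) <-> exists n, H (x - oi X n).
  split=> [[n /= /esym e]|[n /qk /eqP]]; first by exists n; apply/qk; rewrite linearB e subrr.
  by rewrite linearB subr_eq0 => /eqP e; exists n.
have flatQ : rflat (im (q \o oi X)).
  move=> k0 k1 k2 r0 r1 fr x hx; have [x' x'E] := choice (fun i => qs (x i)).
  have [j|y hy] := Hf _ _ _ _ _ fr x'.
    by apply/imE; rewrite (act_linear q) (act_ext _ _ x'E).
  exists (fun i => q (y i)) => i; rewrite -x'E -(act_linear q) -linearB.
  exact/imE.
exists (Obj inji pi0 flatQ), q; split=> //.
Qed.

(* Terms for the closure of one element under the module operations and under solving
   finite linear systems modulo a submodule. *)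
Inductive lam :=
| lgen
| ladd of lam & lam
| lscale of R & lam
| lsol k1 k0 of ('I_k0 -> 'I_k1 -> R) & ('I_k0 -> lam) & 'I_k1.

(* A bound for the irreducible objects that depends only on [N] and [M]. The value of
   [tnode D q b l] is the [l]-th entry of some [lam]-shaped configuration lying over [q] that
   extends the values of [b] on [D]. *)
Inductive tree :=
| tleaf of N
| tadd of tree & tree
| tscale of R & tree
| tnode of (lam -> Prop) & (lam -> M) & (lam -> tree) & lam.

(** * Bounding the size of irreducible objects *)

Section Bound.
Variable X : obj.

Definition lam_hom (e : lam -> X) :=
  (forall l l', e (ladd l l') = e l + e l') /\ (forall r l, e (lscale r l) = r *: e l).

Definition lam_type (D : lam -> Prop) (q : lam -> M) (s e : lam -> X) :=
  [/\ lam_hom e, forall l, op X (e l) = q l & forall l, D l -> e l = s l].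

(** One choice for each triple [D], [q], [s], so that a tree can name its values; zero is a
    placeholder when no configuration exists. *)
Definition realize D q s : lam -> X :=
  if pselect (exists e, lam_type D q s e) is left h then sval (cid h) else fun=> 0.

Fixpoint tree_eval (t : tree) : X :=
  match t with
  | tleaf n => oi X n
  | tadd t t' => tree_eval t + tree_eval t'
  | tscale r t => r *: tree_eval t
  | tnode D q b l => realize D q (fun l => tree_eval (b l)) l
  end.

Definition tree_im (x : X) := exists t, tree_eval t = x.

Lemma submod_tree_im : submod tree_im.
Proof.
split; first by exists (tleaf 0); rewrite /= linear0.
by move=> a _ _ [t <-] [t' <-]; exists (tadd (tscale a t) t').
Qed.

(** Take for [D] the positions where the value of [s] is already named by a tree. As [s] itself has
    the required type, the choice made by [realize] is genuine. *)
Lemma realize_copy (s : lam -> X) : lam_hom s ->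
  exists e : lam -> X, [/\ lam_hom e, forall l, op X (e l) = op X (s l),
    forall l, tree_im (e l) & forall l, tree_im (s l) -> e l = s l].
Proof.
move=> shom.
have /choice [b hb] l : exists t, tree_im (s l) -> tree_eval t = s l.
  case: (pselect (tree_im (s l))) => [[t ht]|n]; first by exists t.
  by exists (tleaf 0).
pose D l := tree_im (s l); pose q l := op X (s l).
pose e l := tree_eval (tnode D q b l).
have [h1 h2 h3] : lam_type D q (fun l => tree_eval (b l)) e.
  rewrite /e /= /realize; case: pselect => [h|[]]; first exact: svalP.
  by exists s; split=> // l /hb.
exists e; split=> // l; first by exists (tnode D q b l).
by move=> hl; rewrite h3 // hb.
Qed.

Section Closure.
Variable y0 : X.

Definition lam_solve k1 k0 (r : 'I_k0 -> 'I_k1 -> R) (y : 'I_k0 -> X) : 'I_k1 -> X :=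
  if pselect (exists x : 'I_k1 -> X, forall j, tree_im (act r x j - y j)) is left h
  then sval (cid h) else fun=> 0.

Fixpoint lam_eval (l : lam) : X :=
  match l with
  | lgen => y0
  | ladd l l' => lam_eval l + lam_eval l'
  | lscale r l => r *: lam_eval l
  | lsol k1 k0 r y i => lam_solve r (fun j => lam_eval (y j)) i
  end.

Lemma lam_solveP k1 k0 (r : 'I_k0 -> 'I_k1 -> R) (y : 'I_k0 -> lam) (x : 'I_k1 -> X) :
  (forall j, tree_im (act r x j - lam_eval (y j))) ->
  forall j, tree_im (act r (fun i => lam_eval (lsol r y i)) j - lam_eval (y j)).
Proof.
move=> hx; rewrite /= /lam_solve; case: pselect => [h|[]]; first exact: (svalP (cid h)).
by exists x.
Qed.

End Closure.

Definition lact k1 k0 (r : 'I_k0 -> 'I_k1 -> R) (y : 'I_k1 -> lam) j : lam :=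
  foldr (fun i l => ladd (lscale (r j i) (y i)) l) (lscale 0 lgen) (enum 'I_k1).

Lemma lactE (e : lam -> X) k1 k0 (r : 'I_k0 -> 'I_k1 -> R) y j : lam_hom e ->
  e (lact r y j) = act r (fun i => e (y i)) j.
Proof.
move=> [eD eZ]; rewrite /act -big_enum /lact /=; elim: (enum _) => [|i s IH] /=.
  by rewrite big_nil eZ scale0r.
by rewrite big_cons eD eZ IH.
Qed.

(** If [y0] is not named by a tree, let [s] be the configuration it generates and [e] a copy of [s]
    inside [tree_im]. The differences [s l - e l] form a submodule [H] that meets [tree_im] only in
    zero, because [e] agrees with [s] wherever [s] lies in [tree_im]. Once [H] is shown to be good,
    it vanishes, which puts [y0 = e lgen] in [tree_im]. *)
Lemma irreducible_bound : (forall H, good H -> forall x : X, H x -> x = 0) -> surj tree_eval.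
Proof.
move=> irr y0; apply: contrapT => ny0; pose s := lam_eval y0.
have shom : lam_hom s by [].
have [e [ehom ep eZ eD]] := realize_copy shom.
have hZ := submod_tree_im.
pose H (x : X) := exists l, x = s l - e l.
have HZ x : H x -> tree_im x -> x = 0.
  move=> [l ->] /(submodD hZ)/(_ (eZ l)); rewrite subrK => /eD ->.
  by rewrite subrr.
have Zi n : tree_im (oi X n) by exists (tleaf n).
suff : good H.
  move=> /irr h; apply: ny0; have [t te] := eZ lgen; exists t; rewrite te.
  by apply/esym/eqP; rewrite -subr_eq0; apply/eqP; apply: h; exists lgen.
have hH : submod H.
  split; first by exists (lscale 0 lgen); rewrite !(proj2 shom) !(proj2 ehom) !scale0r subrr.
  move=> a _ _ [l ->] [l' ->]; exists (ladd (lscale a l) l').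
  rewrite (proj1 shom) (proj1 ehom) (proj2 shom) (proj2 ehom).
  by rewrite scalerBr opprD addrACA.
split=> //.
- move=> n Hn; apply: (oi_inj (o := X)); rewrite linear0; exact: HZ.
- by move=> _ [l ->]; rewrite linearB ep subrr.
move=> k0 k1 k2 r0 r1 fr x hx.
have [n hn] := choice hx; have [l hl] := choice hn.
(* [x] solves [r0 x = s l] modulo [tree_im]; so do the witnesses in [lam_eval], and
   subtracting their copies solves [r0 h = s l - e l] exactly. *)
have hxZ j : tree_im (act r0 x j - s (l j)).
  have -> : act r0 x j - s (l j) = oi X (n j) - e (l j).
    by rewrite -[act r0 x j](subrK (oi X (n j))) hl addrAC [_ - _ - s _]addrAC subrr sub0r addrC.
  by apply: submodB.
pose w i := lsol r0 l i.
have hw j : tree_im (act r0 (fun i => s (w i)) j - s (l j)) by apply: lam_solveP hxZ j.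
pose h i := s (w i) - e (w i).
have hh j : act r0 h j = s (l j) - e (l j).
  (* The term [m] stands for [r0 w - l] at [j]. By [hw] its value under [s] lies in [tree_im], so
     [e] gives it the same value. *)
  pose m := ladd (lact r0 w j) (lscale (-1) (l j)).
  have mE (g : lam -> X) : lam_hom g -> g m = act r0 (fun i => g (w i)) j - g (l j).
    by move=> gh; rewrite /m (proj1 gh) (proj2 gh) (lactE _ _ _ gh) scaleN1r.
  have := eD m; rewrite !mE // => /(_ (hw j)) em.
  rewrite actB; apply/eqP; rewrite subr_eq -addrA [- _ + _]addrC addrA; apply/eqP.
  by rewrite -addrA em addrC subrK.
(* After subtracting [h] the system is homogeneous modulo [N], and flatness of [X / N] applies. *)
have [j|y hy] := ob_flat fr (x := fun i => x i - h i).
  exists (n j); rewrite actB hh -hl.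
  by rewrite opprB addrC subrK.
exists y => i; have [n' hn'] := hy i; exists n'.
rewrite hn'; exists (w i).
by rewrite -/(h i) [x i - h i - _]addrAC subKr.
Qed.

End Bound.

(** A linear system is finite, so all its data live in one member of a chain; this is how flatness
    passes to unions. *)
Lemma chain_tuple (T : Type) (F : set (set T)) (A0 : set T) k (x : 'I_k -> T) :
  F A0 -> (forall A B, F A -> F B -> (A `<=` B \/ B `<=` A)%classic) ->
  (forall i, exists2 A, F A & A (x i)) ->
  exists A, [/\ F A, (A0 `<=` A)%classic & forall i, A (x i)].
Proof.
move=> FA0 Ftot hx.
suff [A [FA A0A hA]] : 
    exists A, [/\ F A, (A0 `<=` A)%classic & forall i, i \in enum 'I_k -> A (x i)].
  by exists A; split=> // i; apply: hA; rewrite mem_enum.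
elim: (enum 'I_k) => [|i s [A [FA A0A hA]]]; first by exists A0; split.
have [B FB Bi] := hx i; case: (Ftot _ _ FA FB) => AB.
  exists B; split=> // [y /A0A /AB//|i']; rewrite inE => /orP[/eqP->//|/hA].
  exact: AB.
by exists A; split=> // i'; rewrite inE => /orP[/eqP->|/hA//]; apply: AB.
Qed.

Lemma good0 (X : obj) : good (fun x : X => x = 0).
Proof.
split=> //.
- by split=> // a x y -> ->; rewrite scaler0 addr0.
- by move=> n; rewrite -[0](linear0 (oi X)); apply: oi_inj.
- by move=> x ->; rewrite linear0.
move=> k0 k1 k2 r0 r1 fr x hx; have [j|y hy] := ob_flat fr (x := x).
  by have [n /eqP] := hx j; rewrite subr_eq0 => /eqP ->; exists n.
by exists y => i; have [n <-] := hy i; exists n; rewrite subrr.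
Qed.

(** Factor out a maximal good submodule: the quotient has no nonzero good submodule, so
    [irreducible_bound] applies to it. *)
Lemma reduce_to_bounded (X : obj) : exists (Q : obj) (f : {linear X -> Q}),
  mor f /\ exists t : tree -> Q, surj t.
Proof.
have [F F0 Fgood Ftot|H [Hgood _ Hmax]] := Zorn_nonempty (P := @good X) (good0 X).
  split.
  - split=> [|a x y [A FA Ax] [B FB By]]; first by exists (fun x : X => x = 0).
    have [C [FC Cx Cy]] : exists C, [/\ F C, C x & C y].
      by case: (Ftot _ _ FA FB) => [/(_ _ Ax)|/(_ _ By)]; [exists B|exists A].
    by exists C => //; case: (Fgood _ FC) => [[_ hC] _ _ _]; apply: hC.
  - by move=> n [A FA An]; case: (Fgood _ FA) => _ h _ _; apply: h.
  - by move=> n [A FA An]; case: (Fgood _ FA) => _ _ h _; apply: h.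
  move=> k0 k1 k2 r0 r1 fr x hx; have [n hn] := choice hx.
  have [A [FA _ hA]] := chain_tuple F0 Ftot hn.
  have [_ _ _ /(_ _ _ _ _ _ fr x)[j|y hy]] := Fgood _ FA; first by exists (n j).
  by exists y => i; have [n' An'] := hy i; exists n'; exists A.
have [hH _ _ _] := Hgood.
have [Q [f [fm fs fk]]] := good_quotient Hgood.
exists Q, f; split=> //; exists (@tree_eval Q); apply: irreducible_bound => H' [hH' Hi' Hp' Hf'] q.
have [x <-] := fs q => Hx; apply/fk.
(* The preimage in [X] of a good submodule of [Q] is good and contains [H], so by maximality it is
   contained in [H]. *)
apply: (Hmax (fun x => H' (f x))) => //; last by move=> y /fk; rewrite /= => ->; case: hH'.
have [fi fp] := fm; split.
- split; first by rewrite linear0; case: hH'.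
  by move=> a y z Hy Hz; rewrite linearP; apply: (proj2 hH').
- by move=> n; rewrite fi; apply: Hi'.
- by move=> y /Hp'; rewrite fp.
move=> k0 k1 k2 r0 r1 fr y hy.
have [j|z hz] := Hf' _ _ _ _ _ fr (fun i => f (y i)).
  by have [n hn] := hy j; exists n; rewrite -(act_linear f) -fi -linearB.
have [z' z'E] := choice (fun i => fs (z i)).
exists z' => i; have [n hn] := hz i; exists n.
by rewrite !linearB fi (act_linear f) (act_ext _ _ z'E).
Qed.

End RelativeFlatness.

(** * Objects presented by relations on terms *)

Section Presentations.
Variable R : pzRingType.
Variable fam : forall k0 k1 k2, ('I_k0 -> 'I_k1 -> R) -> ('I_k1 -> 'I_k2 -> R) -> Prop.
Variables N M : lmodType R.
Local Notation obj := (obj fam N M).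

(** With a fixed type [U] of generators, objects are coded by sets of pairs of terms, to which
    Zorn's lemma applies. *)
Inductive tm (U : Type) :=
| mN of N
| madd of tm U & tm U
| mscale of R & tm U
| mg of U.
Arguments mN {U}.

Section Terms.
Variables (U : Type) (mu : U -> M).
Local Notation tm := (tm U).

Fixpoint tdom (G : U -> Prop) (t : tm) : Prop :=
  match t with
  | mN _ => True
  | madd a b => tdom G a /\ tdom G b
  | mscale _ a => tdom G a
  | mg u => G u
  end.

Fixpoint teval (X : lmodType R) (i : N -> X) (g : U -> X) (t : tm) : X :=
  match t with
  | mN n => i n
  | madd a b => teval i g a + teval i g b
  | mscale r a => r *: teval i g a
  | mg u => g u
  end.

Definition tact k1 k0 (r : 'I_k0 -> 'I_k1 -> R) (y : 'I_k1 -> tm) j : tm :=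
  foldr (fun i l => madd (mscale (r j i) (y i)) l) (mN 0) (enum 'I_k1).

Lemma teval_tact (X : lmodType R) (i : {linear N -> X}) g k1 k0 (r : 'I_k0 -> 'I_k1 -> R) y j :
  teval i g (tact r y j) = act r (fun l => teval i g (y l)) j.
Proof.
rewrite /act -big_enum /tact /=; elim: (enum _) => [|l s IH] /=.
  by rewrite big_nil linear0.
by rewrite big_cons IH.
Qed.

Lemma tdom_tact (G : U -> Prop) k1 k0 (r : 'I_k0 -> 'I_k1 -> R) (y : 'I_k1 -> tm) j :
  (forall l, tdom G (y l)) -> tdom G (tact r y j).
Proof. by move=> hy; rewrite /tact; elim: (enum _) => //= l s IH; split. Qed.

Lemma tdom_sub (G G' : U -> Prop) t : (forall u, G u -> G' u) -> tdom G t -> tdom G' t.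
Proof. by move=> GG'; elim: t => //= a IHa b IHb [/IHa ? /IHb ?]. Qed.

(* Encoding objects as partial equivalence relations on terms turns colimits of chains into
   unions. *)
Definition presents (E : set (tm * tm)) (G : U -> Prop) (X : obj) (g : U -> X) :=
  [/\ forall s t, E (s, t) <-> [/\ tdom G s, tdom G t & teval (oi X) g s = teval (oi X) g t],
      forall x, exists2 s, tdom G s & teval (oi X) g s = x
    & forall u, G u -> op X (g u) = mu u].

Definition presented (E : set (tm * tm)) := exists G X g, @presents E G X g.

(** The map to [M] is determined on terms by [mu], whatever the object, so inclusions of
    presentations respect it automatically. *)
Lemma op_teval E G X g t : @presents E G X g -> tdom G t ->
  op X (teval (oi X) g t) = teval (fun=> 0) mu t.
Proof.
move=> [_ _ h]; elim: t => [n|a IHa b IHb [/IHa ha /IHb hb]|r a IH /IH ha|u /h] //=.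
- by rewrite op_oi.
- by rewrite linearD ha hb.
- by rewrite linearZ ha.
Qed.

Lemma presents_dom E G X g t : @presents E G X g -> E (t, t) <-> tdom G t.
Proof. by move=> [h _ _]; split=> [/h[]|ht] //; apply/h. Qed.

Lemma presents_mor E G X g E' G' X' g' :
  @presents E G X g -> @presents E' G' X' g' -> (E `<=` E')%classic ->
  exists f : {linear X -> X'}, mor f /\
    forall t, tdom G t -> f (teval (oi X) g t) = teval (oi X') g' t.
Proof.
move=> hE hE' EE'.
have [h1 h2 h3] := hE; have [h1' h2' h3'] := hE'.
pose rel x x' := exists t, [/\ tdom G t, teval (oi X) g t = x & teval (oi X') g' t = x'].
have relf x y y' : rel x y -> rel x y' -> y = y'.
  move=> [t [dt tx <-]] [t' [dt' tx' <-]].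
  by have /EE' /h1' [] // : E (t, t') by apply/h1; split=> //; rewrite tx.
have [|//|a x x' y y' [t [dt <- <-]] [t' [dt' <- <-]]|f fP] := @linear_of_rel _ X X' rel.
- by move=> x; have [t dt tx] := h2 x; exists (teval (oi X') g' t), t.
- by exists (madd (mscale a t) t').
have fE t : tdom G t -> f (teval (oi X) g t) = teval (oi X') g' t.
  by move=> dt; apply: relf (fP _) _; exists t.
exists f; split=> //; split=> [n|x]; first exact: (fE (mN n)).
have [t [dt <- <-]] := fP x; rewrite (op_teval hE) //.
rewrite (op_teval hE') //; apply/(presents_dom _ hE').
by apply: EE'; apply/(presents_dom _ hE).
Qed.

Lemma obj_id_flat : rflat fam (im (idfun : {linear N -> N})).
Proof.
by move=> k0 k1 k2 r0 r1 _ x _; exists (fun=> 0) => i; exists (x i - act r1 (fun=> 0) i).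
Qed.

(** The initial object, with zero cokernel; the starting points of the later Zorn arguments are
    built from it. *)
Definition obj_id : obj :=
  @Obj _ fam N M N idfun \0 (fun x y e => e) (fun=> erefl) obj_id_flat.

Lemma presents_id : presents (fun st => [/\ tdom (fun=> False) st.1, tdom (fun=> False) st.2
    & teval (idfun : N -> N) (fun=> 0) st.1 = teval (idfun : N -> N) (fun=> 0) st.2])
  (fun=> False) (X := obj_id) (fun=> 0).
Proof. by split=> // x; exists (mN x). Qed.

(** The successor step of the Zorn arguments: a morphism [k] becomes an enlargement of the
    presentation once there are enough fresh generators to name every element of its target. Terms
    identified by [k] become related. *)
Lemma presents_extend E G (X : obj) (g : U -> X) (X' : obj) (k : {linear X -> X'}) (I : Type)
    (t : I -> X') (c : I -> U) :
  @presents E G X g -> mor k -> surj t -> injective c -> (forall i, ~ G (c i)) ->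
  (forall i, mu (c i) = op X' (t i)) ->
  exists E' g', [/\ @presents E' (fun u => G u \/ exists i, c i = u) X' g', (E `<=` E')%classic,
    forall s, tdom G s -> teval (oi X') g' s = k (teval (oi X) g s)
    & forall i, g' (c i) = t i].
Proof.
move=> [h1 h2 h3] [ki kp] tsurj cinj cG cmu.
pose g' u := if pselect (G u) is left _ then k (g u) else
  if pselect (exists i, c i = u) is left h then t (sval (cid h)) else 0.
pose G' u := G u \/ exists i, c i = u.
have g'G u : G u -> g' u = k (g u) by move=> Gu; rewrite /g'; case: pselect.
have g'c i : g' (c i) = t i.
  rewrite /g'; case: pselect => [/cG//|_]; case: pselect => [h|[]]; last by exists i.
  by congr t; apply: cinj; exact: (svalP (cid h)).
have g'E s : tdom G s -> teval (oi X') g' s = k (teval (oi X) g s).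
  elim: s => [n|a IHa b IHb [/IHa ha /IHb hb]|r a IH /IH ha|u /g'G] //=.
  - by rewrite ha hb linearD.
  - by rewrite ha linearZ.
have GG' s : tdom G s -> tdom G' s by apply: tdom_sub => u; left.
exists (fun st => [/\ tdom G' st.1, tdom G' st.2
  & teval (oi X') g' st.1 = teval (oi X') g' st.2]), g'; split=> //.
  split=> //.
  - by move=> x; have [i <-] := tsurj x; exists (mg (c i)) => //=; right; exists i.
  - by move=> u [Gu|[i <-]]; [rewrite g'G // kp h3|rewrite g'c].
by move=> [s s'] /h1 [ds ds' e]; split; [exact: GG'|exact: GG'|rewrite /= !g'E // e].
Qed.

(** * Unions of chains of presentations *)

Section Union.
Variables (F : set (set (tm * tm))) (A0 : set (tm * tm)).
Hypotheses (FA0 : F A0) (Ftot : forall A B, F A -> F B -> (A `<=` B \/ B `<=` A)%classic)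
  (Fpres : forall A, F A -> presented A).
Let E : set (tm * tm) := fun st => exists2 A, F A & A st.

Lemma union_common (a b : tm * tm) : E a -> E b -> exists A, [/\ F A, A a & A b].
Proof.
move=> [A FA Aa] [B FB Bb].
by case: (Ftot FA FB) => [/(_ _ Aa)|/(_ _ Bb)]; [exists B|exists A].
Qed.

Lemma union_common3 (a b c : tm * tm) : E a -> E b -> E c -> exists A, [/\ F A, A a, A b & A c].
Proof.
move=> Ea Eb [C FC Cc]; have [A [FA Aa Ab]] := union_common Ea Eb.
case: (Ftot FA FC) => [AC|/(_ _ Cc)]; last by exists A.
by exists C; split=> //; apply: AC.
Qed.

(** To relate two terms in the union it suffices to compare them in one member; each module law is
    checked this way. *)
Let dom_law (s t : tm) A : F A ->
  (forall G X g, @presents A G X g ->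
     [/\ tdom G s, tdom G t & teval (oi X) g s = teval (oi X) g t]) ->
  E (s, t).
Proof.
move=> FA h; exists A => //; have [G [X [g hA]]] := Fpres FA; have [h1 _ _] := hA.
exact/h1/(h _ _ _ hA).
Qed.

Lemma union_realize : exists (Q : lmodType R) (f : tm -> Q),
  [/\ forall q, exists2 x, E (x, x) & f x = q,
      forall x y, E (x, x) -> E (y, y) -> (f x = f y <-> E (x, y)),
      f (mN 0) = 0,
      forall x y, E (x, x) -> E (y, y) -> f (madd x y) = f x + f y
    & forall a x, E (x, x) -> f (mscale a x) = a *: f x].
Proof.
unshelve epose (P := @PreModule R tm (fun s t => E (s, t)) (mN 0) (@madd U) (@mscale U)
  _ _ _ _ _ _ _ _ _ _ _ _ _); last exact: (premodule_realize P).
- move=> x y [A FA Axy]; apply: (dom_law FA) => G X g [h1 _ _].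
  by have [? ? ->] := (iffLR (h1 _ _) Axy).
- move=> x y z Exy Eyz; have [A [FA Axy Ayz]] := union_common Exy Eyz.
  apply: (dom_law FA) => G X g [h1 _ _].
  by have [? ? ->] := (iffLR (h1 _ _) Axy); have [? ? ->] := (iffLR (h1 _ _) Ayz).
- by apply: (dom_law FA0) => G X g [h1 _ _].
- move=> x x' y y' Ex Ey; have [A [FA Ax Ay]] := union_common Ex Ey.
  apply: (dom_law FA) => G X g [h1 _ _].
  have [? ? ex] := (iffLR (h1 _ _) Ax); have [? ? ey] := (iffLR (h1 _ _) Ay).
  by split=> //=; rewrite ex ey.
- move=> a x x' [A FA Ax]; apply: (dom_law FA) => G X g [h1 _ _].
  by have [? ? ex] := (iffLR (h1 _ _) Ax); split=> //=; rewrite ex.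
- move=> x y Ex Ey; have [A [FA Ax Ay]] := union_common Ex Ey.
  apply: (dom_law FA) => G X g hA.
  have := iffLR (presents_dom _ hA) Ax; have := iffLR (presents_dom _ hA) Ay.
  by split=> //=; rewrite addrC.
- move=> x y z Ex Ey Ez; have [A [FA Ax Ay Az]] := union_common3 Ex Ey Ez.
  apply: (dom_law FA) => G X g hA.
  have := iffLR (presents_dom _ hA) Ax; have := iffLR (presents_dom _ hA) Ay.
  have := iffLR (presents_dom _ hA) Az.
  by split=> //=; rewrite addrA.
- move=> x [A FA Ax]; apply: (dom_law FA) => G X g hA; have dx := iffLR (presents_dom _ hA) Ax.
  by split=> //=; rewrite linear0 add0r.
- move=> x [A FA Ax]; apply: (dom_law FA) => G X g hA; have dx := iffLR (presents_dom _ hA) Ax.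
  by split=> //=; rewrite linear0 scaleN1r addNr.
- move=> a b x [A FA Ax]; apply: (dom_law FA) => G X g hA; have dx := iffLR (presents_dom _ hA) Ax.
  by split=> //=; rewrite scalerA.
- move=> x [A FA Ax]; apply: (dom_law FA) => G X g hA; have dx := iffLR (presents_dom _ hA) Ax.
  by split=> //=; rewrite scale1r.
- move=> a x y Ex Ey; have [A [FA Ax Ay]] := union_common Ex Ey.
  apply: (dom_law FA) => G X g hA.
  have := iffLR (presents_dom _ hA) Ax; have := iffLR (presents_dom _ hA) Ay.
  by split=> //=; rewrite scalerDr.
- move=> a b x [A FA Ax]; apply: (dom_law FA) => G X g hA; have dx := iffLR (presents_dom _ hA) Ax.
  by split=> //=; rewrite scalerDl.
Qed.

Lemma union_presented : presented E.
Proof.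
have [Q [f [fs fE f0 fD fZ]]] := union_realize.
have EN n : E (mN n, mN n) by apply: (dom_law FA0) => G X g _.
have Esub A : F A -> forall s t, A (s, t) -> E (s, t) by move=> FA s t ?; exists A.
have fEq s t : E (s, t) -> f s = f t.
  move=> Est; have [A FA Ast] := Est; have [G [X [g hA]]] := Fpres FA; have [h1 _ _] := hA.
  have [ds dt _] := iffLR (h1 _ _) Ast.
  by apply/fE => //; apply: (Esub _ FA); apply/(presents_dom _ hA).
have EE s t : E (s, t) -> E (s, s) /\ E (t, t).
  move=> [A FA Ast]; have [G [X [g hA]]] := Fpres FA; have [h1 _ _] := hA.
  have [ds dt _] := iffLR (h1 _ _) Ast.
  by split; apply: (Esub _ FA); apply/(presents_dom _ hA).
have [||a n n' _ _ <- <-|i iP] := @linear_of_rel _ N Q (fun n q => f (mN n) = q).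
- by move=> n; exists (f (mN n)).
- by move=> n q q' <-.
- rewrite -fZ // -fD //; last first.
    by apply: (dom_law FA0) => G X g _.
  by apply: fEq; apply: (dom_law FA0) => G X g _; split=> //=; rewrite linearP.
have tmuE s t : E (s, t) -> teval (fun=> 0) mu s = teval (fun=> 0) mu t.
  move=> [A FA Ast]; have [G [X [g hA]]] := Fpres FA; have [h1 _ _] := hA.
  have [ds dt e] := iffLR (h1 _ _) Ast.
  by rewrite -(op_teval hA ds) -(op_teval hA dt) e.
pose rel q m := exists t, [/\ E (t, t), f t = q & teval (fun=> 0) mu t = m].
have relf q m m' : rel q m -> rel q m' -> m = m'.
  by move=> [t [Et tq <-]] [t' [Et' tq' <-]]; apply: tmuE; apply/fE => //; rewrite tq.
have [|//|a q q' m m' [t [Et <- <-]] [t' [Et' <- <-]]|p pP] := @linear_of_rel _ Q M rel.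
- by move=> q; have [t Et tq] := fs q; exists (teval (fun=> 0) mu t), t.
- exists (madd (mscale a t) t').
  have Eat : E (mscale a t, mscale a t).
    have [A FA At] := Et; apply: (dom_law FA) => G X g hA.
    by have dt := iffLR (presents_dom _ hA) At.
  split=> //; last by rewrite fD // fZ.
  have [A [FA At At']] := union_common Eat Et'; apply: (dom_law FA) => G X g hA.
  by have dt := iffLR (presents_dom _ hA) At; have dt' := iffLR (presents_dom _ hA) At'.
have pE t : E (t, t) -> p (f t) = teval (fun=> 0) mu t.
  by move=> Et; apply: relf (pP _) _; exists t.
pose G u := E (mg u, mg u); pose g u := f (mg u).
have domE t : E (t, t) <-> tdom G t.
  split=> [[A FA At]|].
    have [GA [X [h hA]]] := Fpres FA.
    have := iffLR (presents_dom _ hA) At; apply: tdom_sub => u Gu.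
    by apply: (Esub _ FA); apply/(presents_dom _ hA).
  elim: t => [n _|a IHa b IHb [/IHa Ea /IHb Eb]|r a IHa /IHa [A FA Aa]|u] //=.
    have [A [FA Aa Ab]] := union_common Ea Eb; apply: (dom_law FA) => GA X h hA.
    by have dt := iffLR (presents_dom _ hA) Aa; have dt' := iffLR (presents_dom _ hA) Ab.
  by apply: (dom_law FA) => GA X h hA; have dt := iffLR (presents_dom _ hA) Aa.
have evE t : E (t, t) -> teval i g t = f t.
  elim: t => [n _|a IHa b IHb /domE[/domE Ea /domE Eb]|r a IHa /domE da|u _] //=.
  - by rewrite IHa // IHb // fD.
  - by have /domE Ea : tdom G a by []; rewrite IHa // fZ.
have i_inj : injective i.
  move=> n n'; rewrite -!iP => /(fE _ _ (EN n) (EN n')) [A FA Ann'].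
  have [GA [X [h [h1 _ _]]]] := Fpres FA.
  by have [_ _ /oi_inj] := iffLR (h1 _ _) Ann'.
have pi0 n : p (i n) = 0 by rewrite -iP pE.
have flatQ : rflat fam (im i).
  move=> k0 k1 k2 r0 r1 fr x hx.
  have /choice [t tE] l : exists t, E (t, t) /\ teval i g t = x l.
    by have [t Et tx] := fs (x l); exists t; rewrite evE.
  have [n hn] := choice hx.
  (* Two uses of [chain_tuple] find one member containing the terms [t] and the finitely many
     relations of the system. It is solved there by flatness, and the solution is read back as
     terms. *)
  have [B [FB _ Bt]] := chain_tuple (x := fun l => (t l, t l)) FA0 Ftot (fun l => proj1 (tE l)).
  have Er j : E (tact r0 t j, mN (n j)).
    have Et : E (tact r0 t j, tact r0 t j) by apply/domE/tdom_tact => l; apply/domE; case: (tE l).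
    apply/fE => //; rewrite iP -evE // teval_tact hn.
    by apply: act_ext => l; case: (tE l).
  have [A [FA BA Ar]] := chain_tuple (x := fun j => (tact r0 t j, mN (n j))) FB Ftot Er.
  have [GA [X [h hA]]] := Fpres FA; have [h1 h2 _] := hA.
  have [j|y hy] := ob_flat fr (x := fun l => teval (oi X) h (t l)).
    by exists (n j); have [_ _] := iffLR (h1 _ _) (Ar j); rewrite teval_tact.
  have /choice [z zE] l : exists z, tdom GA z /\ teval (oi X) h z = y l.
    by have [z dz zy] := h2 (y l); exists z.
  have Ez l : E (z l, z l).
    by apply: (Esub _ FA); apply/(presents_dom _ hA); case: (zE l).
  exists (fun l => teval i g (z l)) => l; have [n' hn'] := hy l; exists n'.
  have [_ <-] := tE l; rewrite -teval_tact -iP -scaleN1r.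
  rewrite -[_ + _]/(teval i g (madd (t l) (mscale (-1) (tact r1 z l)))).
  have Es : E (madd (t l) (mscale (-1) (tact r1 z l)), mN n').
    apply: (Esub _ FA); apply/h1; split=> //=.
      split; first by apply/(presents_dom _ hA); apply: BA.
      by apply: tdom_tact => m; case: (zE m).
    rewrite hn' scaleN1r teval_tact; congr (_ - _).
    by apply: act_ext => m; case: (zE m).
  by rewrite evE ?(fEq _ _ Es) //; case: (EE _ _ Es).
exists G, (Obj i_inj pi0 flatQ), g; split.
- move=> s t; split=> [Est|[/domE Es /domE Et]].
    have [Es Et] := EE _ _ Est; split; [exact/domE|exact/domE|].
    by rewrite /= !evE // (fEq _ _ Est).
  by rewrite /= !evE // => /fE; apply.
- by move=> x; have [t Et tx] := fs x; exists t; [apply/domE|rewrite /= evE].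
- by move=> u Gu; rewrite /= pE.
Qed.

End Union.
End Terms.
End Presentations.

Arguments mN {R N U}.
Arguments mg {R N U}.

(** * Rigid and weakly terminal objects *)

Lemma Cantor_no_injection (T : Type) (f : (T -> Prop) -> T) : ~ injective f.
Proof.
move=> finj; pose D t := exists2 P : T -> Prop, f P = t & ~ P t.
have nD : ~ D (f D) by move=> h; have [P /finj-> ] := h; apply.
by apply: (nD); exists D.
Qed.

Lemma inj_surj_bij (A B : Type) (f : A -> B) : injective f -> surj f -> bijective f.
Proof.
move=> finj /choice [g gK]; exists g => // x; exact: finj.
Qed.

Section Terminal.
Variable R : pzRingType.
Variable fam : forall k0 k1 k2, ('I_k0 -> 'I_k1 -> R) -> ('I_k1 -> 'I_k2 -> R) -> Prop.
Variables N M : lmodType R.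
Local Notation obj := (obj fam N M).
Local Notation tree := (tree N M).

Definition rigid (X : obj) := forall (Y : obj) (f : {linear X -> Y}), mor f -> injective f.

Lemma linear_inj (X Y : lmodType R) (f : {linear X -> Y}) :
  (forall x, f x = 0 -> x = 0) -> injective f.
Proof.
move=> h x y /eqP; rewrite -subr_eq0 -linearB => /eqP/h/eqP.
by rewrite subr_eq0 => /eqP.
Qed.

Lemma mor_oi (X : obj) : mor (X := obj_id fam N M) (oi X).
Proof. by split=> // n; rewrite op_oi. Qed.

(* A generator [kill x t m] is only used in a step that kills the term [x]. As [x] can be
   killed only once, this generator is always fresh. *)
Inductive killgen := kill of tm N killgen & tree & M.
Definition kill_mu (u : killgen) := let: kill _ _ m := u in m.

(** Zorn's lemma is applied to presentations in which [kill x t m] occurs only if [x] is already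
    related to zero. If a morphism out of a maximal one killed a nonzero element, named by [x], all
    generators [kill x _ _] would be fresh, and a bounded object below the target would properly
    extend the presentation. *)
Lemma to_rigid (X : obj) : exists (Q : obj) (f : {linear X -> Q}), mor f /\ rigid Q.
Proof.
have [X1 [f1 [f1m [t1 t1s]]]] := reduce_to_bounded X.
(* The first stage kills the term [mN 0], for which the invariant holds trivially. *)
have cinj : injective (fun t => kill (mN 0) t (op X1 (t1 t))) by move=> t t' [].
have [E1 [g1 [E1p _ _ _]]] := presents_extend
  (presents_id fam N kill_mu) (mor_oi X1) t1s cinj (fun _ => id) (fun=> erefl).
pose C (E : set (tm N killgen * tm N killgen)) :=
  presented fam kill_mu E /\
  forall x t m, E (mg (kill x t m), mg (kill x t m)) -> E (x, mN 0).
have CE1 : C E1.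
  split; first by eexists; exists X1, g1; exact: E1p.
  move=> x t m /(presents_dom _ E1p) /= [//|[t' [<- _ _]]].
  exact/(presents_dom _ E1p).
have [F FE1 FC Ftot|E [[[G [Q [g EQ]]] EC] E1E Emax]] := Zorn_nonempty (P := C) CE1.
  split; first by apply: union_presented FE1 Ftot _ => A /FC[].
  by move=> x t m [A FA Au]; exists A => //; case: (FC _ FA) => _; apply; exact: Au.
have [f [fm _]] := presents_mor E1p EQ E1E.
exists Q, (f \o f1); split; first exact: mor_comp fm.
move=> Y k km; apply: linear_inj => z kz; apply: contrapT => z0.
have [Y' [k' [k'm [t ts]]]] := reduce_to_bounded Y.
have [EE EQs _] := EQ; have [x dx xz] := EQs z.
have nEx : ~ E (x, mN 0) by move=> /EE [_ _] /=; rewrite xz linear0.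
have [|c|//|E' [g' [E'p EE' g'E g'c]]] := presents_extend (t := t)
  (c := fun s => kill x s (op Y' (t s))) EQ (mor_comp km k'm) ts.
- by move=> s s' [].
- by move=> /(presents_dom (mg _) EQ) /EC.
have E'x : E' (x, mN 0).
  have [h1 _ _] := E'p; apply/h1; split=> //; first by apply: tdom_sub dx => u; left.
  by rewrite g'E //= xz kz !linear0.
apply: nEx; apply: (Emax E' _ EE' _ E'x); split; first by eexists; exists Y', g'; exact: E'p.
move=> x' s m /(presents_dom _ E'p) /= [Gu|[s' [<- _ _]]] //.
by apply: EE'; apply: EC; apply/(presents_dom (mg _) EQ); exact: Gu.
Qed.

(** A rigid object embeds in the bounded object to which it maps, so the trees enumerate it too. *)
Lemma rigid_bound (X : obj) : rigid X -> exists t : tree -> X, surj t.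
Proof.
move=> Xr; have [Q [f [fm [t ts]]]] := reduce_to_bounded X; have finj := Xr _ _ fm.
have /choice [s sP] a : exists x, forall y, f y = t a -> x = y.
  case: (pselect (exists x, f x = t a)) => [[x xa]|nx]; last first.
    by exists 0 => y ya; case: nx; exists y.
  by exists x => y; rewrite -xa => /finj.
by exists s => x; have [a ax] := ts (f x); exists a; apply: sP.
Qed.

Lemma rigid_maximal : exists G : obj, rigid G /\
  forall (Q : obj) (f : {linear G -> Q}), rigid Q -> mor f -> bijective f.
Proof.
pose U : Type := ((tree -> Prop) * option tree * M)%type; pose mu (u : U) : M := u.2.
have [X1 [_ [_ X1r]]] := to_rigid (obj_id fam N M).
have ext (X : obj) (x : X) (b : tree -> Prop) : rigid X -> exists t : option tree -> X,
    [/\ surj t, t None = x & injective (fun o => (b, o, op X (t o)) : U)].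
  move=> /rigid_bound [t ts]; exists (fun o => if o is Some a then t a else x); split=> //.
    by move=> y; have [a <-] := ts y; exists (Some a).
  by move=> o o' [].
have [t1 [t1s _ c1]] := ext X1 0 (fun=> True) X1r.
have [E1 [g1 [E1p _ _ _]]] := presents_extend (mu := mu)
  (presents_id fam N mu) (mor_oi X1) t1s c1 (fun _ => id) (fun=> erefl).
pose T := tm N U.
pose C (E : set (T * T)) := [/\ exists G X g, @presents _ fam N M U mu E G X g /\ rigid X,
  forall b o m, E (mg (b, o, m), mg (b, o, m)) ->
    exists m', E (mg (b, None, m'), mg (b, None, m'))
  & forall b b' m m', E (mg (b, None, m), mg (b', None, m')) -> b = b'].
have CE1 : C E1.
  split; first by eexists; exists X1, g1; split; [exact: E1p|].
    move=> b o m /(presents_dom _ E1p) /= [//|[o' [<- _ _]]].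
    exists (op X1 (t1 None)); apply/(presents_dom (mg _) E1p); right.
    by exists None.
  move=> b b' m m' h; have [/(_ _ _) h1 _ _] := E1p.
  by have [/= [//|[o [<- _ _]]] [//|[o' [<- _ _]]]] := iffLR (h1 _ _) h.
have [F FE1 FC Ftot|E [[[G [Q [g [EQ Qr]]]] EC1 EC2] E1E Emax]] := Zorn_nonempty (P := C) CE1.
  have [G [X [g Xp]]] : presented fam mu (fun x => exists2 A, F A & A x).
    by apply: union_presented FE1 Ftot _ => A /FC[[G [X [g [h _]]]] _ _]; exists G, X, g.
  split.
  (* Rigidity passes to the union: an element killed by [f] comes from a rigid member of the chain,
     whose composite with [f] is injective. *)
  - exists G, X, g; split=> // Y f fm; apply: linear_inj => z fz.
    have [h1 h2 _] := Xp; have [s /(presents_dom _ Xp) [A FA As] sz] := h2 z.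
    have [[GA [XA [gA [XAp XAr]]]] _ _] := FC _ FA.
    have AE : (A `<=` (fun x => exists2 A, F A & A x))%classic by move=> x Ax; exists A.
    have [k [km kE]] := presents_mor XAp Xp AE.
    have ds := iffLR (presents_dom _ XAp) As.
    rewrite -sz -kE // -[RHS](linear0 k); congr (k _).
    apply: (XAr _ _ (mor_comp km fm)).
    by rewrite /= kE // sz fz !linear0.
  - move=> b o m [A FA Au]; have [_ h _] := FC _ FA; have [m' hm'] := h _ _ _ Au.
    by exists m', A.
  - by move=> b b' m m' [A FA Au]; have [_ _ h] := FC _ FA; apply: h Au.
exists Q; split=> // Q' k Q'r km; have kinj := Qr _ _ km.
apply: inj_surj_bij => // q; apply: contrapT => nq.
have [EE _ _] := EQ.
(* If every label were used, choosing trees for the elements named with [None] would inject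
   [tree -> Prop] into [tree]. *)
have [b bfresh] : exists b, forall o m, ~ G (b, o, m).
  apply: contrapT => nb; have [t ts] := rigid_bound Qr.
  have /choice [m hm] b : exists m, G (b, None, m).
    apply: contrapT => nm; apply: nb; exists b => o m Gu.
    have [|m' hm'] := EC1 b o m; first exact/(presents_dom (mg _) EQ).
    by apply: nm; exists m'; apply/(presents_dom (mg _) EQ).
  have /choice [a aE] b : exists a, t a = g (b, None, m b) by apply: ts.
  apply: (@Cantor_no_injection _ a) => b b' ab.
  by apply: (EC2 b b' (m b) (m b')); apply/EE; split=> //=; rewrite -!aE ab.
have [t [ts tN tc]] := ext Q' q b Q'r.
have [E' [g' [E'p EE' g'E g'c]]] := presents_extend EQ km ts tc (fun o => bfresh _ _) (fun=> erefl).
have E'b : E' (mg (b, None, op Q' q), mg (b, None, op Q' q)).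
  by apply/(presents_dom (mg _) E'p); right; exists None; rewrite tN.
have E'C : C E'.
  split; first by eexists; exists Q', g'; split; [exact: E'p|].
    move=> b' o m /(presents_dom _ E'p) /= [Gu|[o' [<- _ _]]]; last by exists (op Q' q).
    have [|m' hm'] := EC1 b' o m; first exact/(presents_dom (mg _) EQ).
    by exists m'; apply: EE'.
  (* An old generator takes its value in the image of [k], whereas the new one with [None] names
     [q], which lies outside that image. *)
  have new b1 b2 m1 m2 : G (b1, None, m1) -> (exists o, (b, o, op Q' (t o)) = (b2, None, m2)) ->
      g' (b1, None, m1) = g' (b2, None, m2) -> False.
    move=> Gu [o [<- -> <-]]; rewrite g'c tN.
    have /= -> := g'E (mg (b1, None, m1)) Gu.
    by move=> e; apply: nq; eexists; exact: e.
  move=> b1 b2 m1 m2; have [h1 _ _] := E'p => /h1 [/= [G1|o1] [G2|o2] e].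
  - apply: (EC2 b1 b2 m1 m2); apply/EE; split=> //=; apply: kinj.
    by have /= <- := g'E (mg (b1, None, m1)) G1; have /= <- := g'E (mg (b2, None, m2)) G2.
  - by case: (new _ _ _ _ G1 o2 e).
  - by case: (new _ _ _ _ G2 o1 (esym e)).
  - by move: o1 o2 => [o [<- _ _]] [o' [<- _ _]].
apply: (bfresh None (op Q' q)); apply/(presents_dom (mg _) EQ).
exact: Emax E'C EE' _ E'b.
Qed.

(** The cokernel of [N] in the pushout is the direct sum of its cokernels in [G] and in [X], so a
    linear system is solved in each summand separately. *)
Lemma pushout_obj (X G : obj) : exists (W : obj) (a : {linear G -> W}) (b : {linear X -> W}),
  mor a /\ mor b.
Proof.
have [W [a [b [ab Ws Wk Wu]]]] := pushout (oi X) (oi G).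
have [|p [pa pb]] := Wu _ (op G) (op X); first by move=> n; rewrite !op_oi.
have ainj : injective a.
  apply: linear_inj => y ay; have [|n [-> /esym]] := Wk y 0; first by rewrite ay linear0 addr0.
  by rewrite -[RHS](linear0 (oi X)) => /oi_inj ->; rewrite linear0 oppr0.
have iinj : injective (a \o oi G) by move=> x y /ainj/oi_inj.
have pi0 n : p ((a \o oi G) n) = 0 by rewrite /= pa op_oi.
have flatW : rflat fam (im (a \o oi G)).
  move=> k0 k1 k2 r0 r1 fr w hw.
  have [y hy] := choice (fun i => Ws (w i)); have [x hx] := choice hy.
  have hn j : im (oi G) (act r0 y j) /\ im (oi X) (act r0 x j).
    have [n /= hn] := hw j.
    have [|n' [e1 e2]] := Wk (act r0 y j - oi G n) (act r0 x j).
      rewrite linearB hn (act_linear a) (act_linear b) addrAC -actD.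
      by rewrite (act_ext r0 j hx) subrr.
    split; last by exists n'.
    by exists (n - n'); rewrite linearB -e1 addrC subrK.
  have [j|u hu] := ob_flat fr (x := y); first by case: (hn j).
  have [j|v hv] := ob_flat fr (x := x); first by case: (hn j).
  exists (fun l => a (u l) + b (v l)) => l.
  have [n hn1] := hu l; have [n' hn2] := hv l; exists (n + n') => /=.
  rewrite linearD linearD hn1 -ab hn2 hx actD -(act_linear a) -(act_linear b).
  by rewrite !linearB opprD addrACA.
by exists (Obj iinj pi0 flatW), a, b; split; split.
Qed.

Theorem terminal_obj : exists G : obj, (forall X : obj, exists f : {linear X -> G}, mor f) /\
  (forall f : {linear G -> G}, mor f -> bijective f).
Proof.
have [G [Gr Gmax]] := rigid_maximal.
exists G; split=> [X|f fm]; last exact: Gmax.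
have [W [a [b [am bm]]]] := pushout_obj X G.
have [Q [q [qm Qr]]] := to_rigid W.
(* Maximality makes [G -> W -> Q] bijective; its inverse brings the image of [X] in [Q] back to
   [G]. *)
have [h [hK Kh]] := linear_bij_inv (Gmax _ _ Qr (mor_comp am qm)).
exists (h \o (q \o b)); apply: mor_comp (mor_comp bm qm) _.
have [qi qp] := mor_comp am qm.
split=> [n|x]; first by rewrite -qi hK.
by rewrite -[in RHS](Kh x) qp.
Qed.

End Terminal.

(** * The cotorsion pair *)

Section Splitting.
Variable R : pzRingType.
Variables (B E A : lmodType R) (i : {linear B -> E}) (p : {linear E -> A}).
Hypotheses (iinj : injective i) (psurj : surj p) (pk : forall e, p e = 0 <-> im i e).

(** The value [s a] is the unique preimage of [a] killed by [r]. [ext1_zero] asks for sections,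
    whereas minimality of covers and envelopes yields retractions. *)
Lemma section_of_retraction (r : {linear E -> B}) : cancel i r ->
  exists s : {linear A -> E}, cancel s p.
Proof.
move=> ir; have pi0 b : p (i b) = 0 by apply/pk; exists b.
have [|a e e'|c a a' e e' [<- re] [<- re']|s sP] :=
  @linear_of_rel _ A E (fun a e => p e = a /\ r e = 0).
- move=> a; have [e <-] := psurj a; exists (e - i (r e)).
  by rewrite !linearB pi0 ir subr0 subrr.
- move=> [<- re] [/eqP]; rewrite eq_sym -subr_eq0 -linearB => /eqP /pk [b be] re'.
  apply/eqP; rewrite -subr_eq0 -be -[b]ir be linearB re re' subr0 linear0.
  exact: eqxx.
- by rewrite !linearP re re' scaler0 addr0.
by exists s => a; case: (sP a).
Qed.

Lemma retraction_of_section (s : {linear A -> E}) : cancel s p ->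
  exists r : {linear E -> B}, cancel i r.
Proof.
move=> ps; have pi0 b : p (i b) = 0 by apply/pk; exists b.
have [|e b b'|c e e' b b'|r rP] := @linear_of_rel _ E B (fun e b => i b = e - s (p e)).
- by move=> e; apply/pk; rewrite linearB ps subrr.
- by move=> <- /iinj.
- by move=> ib ib'; rewrite (linearP i) (linearP p) (linearP s) ib ib' scalerBr opprD addrACA.
by exists r => b; apply: iinj; rewrite rP pi0 linear0 subr0.
Qed.

End Splitting.

(** * Covers, envelopes and orthogonality for an abstract family of matrices *)

Section Perfect.
Variable R : pzRingType.
Variable fam : forall k0 k1 k2, ('I_k0 -> 'I_k1 -> R) -> ('I_k1 -> 'I_k2 -> R) -> Prop.
Hypothesis fam_comp0 : forall k0 k1 k2 (r0 : 'I_k0 -> 'I_k1 -> R) (r1 : 'I_k1 -> 'I_k2 -> R),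
  fam r0 r1 -> forall j l, \sum_i r0 j i * r1 i l = 0.

Definition fam_flat : mclass R := fun X => rflat fam (fun x : X => x = 0).

Hypothesis fam_regular : fam_flat R^o.

Lemma rflat_quotient (W C : lmodType R) (v : {linear W -> C}) (S : W -> Prop) :
  surj v -> (forall w, v w = 0 <-> S w) -> (rflat fam S <-> fam_flat C).
Proof.
move=> vs vk; split=> h k0 k1 k2 r0 r1 fr x hx.
- have [x' x'E] := choice (fun l => vs (x l)).
  have [j|y hy] := h _ _ _ _ _ fr x'; first by apply/vk; rewrite (act_linear v) (act_ext _ _ x'E).
  by exists (fun l => v (y l)) => l; rewrite -x'E -(act_linear v) -linearB; apply/vk.
- have [j|y hy] := h _ _ _ _ _ fr (fun l => v (x l)); first by rewrite -(act_linear v); apply/vk.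
  have [y' y'E] := choice (fun l => vs (y l)).
  by exists y' => l; apply/vk; rewrite linearB (act_linear v) (act_ext _ _ y'E).
Qed.

Lemma flat_extension (X W C : lmodType R) (j : {linear X -> W}) (v : {linear W -> C})
    (S : X -> Prop) :
  injective j -> surj v -> (forall w, v w = 0 <-> im j w) -> rflat fam S -> fam_flat C ->
  rflat fam (fun w => exists2 x, S x & j x = w).
Proof. by move=> jinj vs vk Sf Cf; apply: rflat_ext => //; apply/(rflat_quotient vs vk). Qed.

Lemma rflat_iff (X : lmodType R) (S S' : X -> Prop) : (forall x, S x <-> S' x) ->
  rflat fam S -> rflat fam S'.
Proof. by move=> SS'; have -> : S = S' by apply/predeqP. Qed.

Lemma flat_covering : covering fam_flat.
Proof.
move=> M; pose N : lmodType R := 'rV[R]_0.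
have N0 (n : N) : n = 0 by exact: thinmx0.
have imN (Y : lmodType R) (i : {linear N -> Y}) y : im i y <-> y = 0.
  by split=> [[n <-]|->]; [rewrite (N0 n) linear0|exists 0; rewrite linear0].
have [G [Gt Ge]] := terminal_obj fam N M.
exists G, (op G); split.
- by apply: rflat_iff (@ob_flat _ _ _ _ G) => x; apply: imN.
- move=> Y Yf g.
  have inj0 : injective (\0 : {linear N -> Y}) by move=> n n' _; rewrite (N0 n) (N0 n').
  have g0 n : g ((\0 : {linear N -> Y}) n) = 0 by rewrite linear0.
  have Yf' : rflat fam (im (\0 : {linear N -> Y})).
    by apply: rflat_iff Yf => y; split=> /imN.
  have [h [_ hp]] := Gt (Obj inj0 g0 Yf').
  by exists h.
- by move=> g gp; apply: Ge; split=> // n; rewrite (N0 n) !linear0.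
Qed.

(** Since [R] is flat, the map from [R] sending 1 to [m] lifts through the cover. *)
Lemma flat_cover_surj (M X : lmodType R) (f : {linear X -> M}) : is_cover fam_flat f -> surj f.
Proof.
move=> [_ fpre _] m.
have [||a r r' x x' -> ->|g gP] := @linear_of_rel R R^o M (fun r x => x = (r : R) *: (m : M)).
- by move=> r; exists ((r : R) *: (m : M)).
- by move=> r x x' -> ->.
- by rewrite scalerDl scalerA.
have [h hE] := fpre _ fam_regular g.
by exists (h (1 : R^o)); rewrite hE gP scale1r.
Qed.

(* Wakamatsu's lemma. *)
Lemma flat_cover_kernel (M P K : lmodType R) (f : {linear P -> M}) (i : {linear K -> P}) :
  is_cover fam_flat f -> injective i -> (forall x, f x = 0 <-> im i x) ->
  perp_right fam_flat K.
Proof.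
move=> [Pf fpre fmin] iinj fk C Cf E j q jinj qs qk.
(* Pushing the extension [E] of [C] by [K] out along [i] gives an extension [W] of [C] by [P], which
   is flat, with a map [u] to [M] extending [f]. *)
have [W [a [b [ab Ws Wk Wu]]]] := pushout j i.
have [|u [ua ub]] := Wu _ f \0; first by move=> k /=; apply/esym/fk; exists k.
have [|v [va vb]] := Wu _ \0 q; first by move=> k /=; apply/qk; exists k.
have ainj : injective a.
  apply: linear_inj => y ay; have [|n [-> /esym]] := Wk y 0; first by rewrite ay linear0 addr0.
  by rewrite -[RHS](linear0 j) => /jinj ->; rewrite linear0 oppr0.
have vs : surj v by move=> c; have [e <-] := qs c; exists (b e).
have vk w : v w = 0 <-> im a w.
  split=> [|[x <-]]; last by rewrite va.
  have [y [e ->]] := Ws w; rewrite linearD va vb add0r => /qk [k <-].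
  by exists (y + i k); rewrite linearD ab.
have Wf : fam_flat W.
  apply: rflat_iff (flat_extension ainj vs vk Pf Cf) => w.
  by split=> [[x -> <-]|->]; [rewrite linear0|exists 0; rewrite ?linear0].
(* The lift [h] of [u] restricts on [P] to an endomorphism over [M], hence to an automorphism, with
   inverse [s]. *)
have [h hE] := fpre _ Wf u.
have ha x : f ((h \o a) x) = f x by rewrite /= hE ua.
have [s [sK Ks]] := linear_bij_inv (fmin _ ha).
have fs y : f (s y) = f y by rewrite -[in RHS](Ks y) ha.
(* The composite of [b], [h] and [s] takes [E] into the kernel of [f], and so defines a retraction
   [r] of [E] onto [K]. *)
have [||c e e' k k' ik ik'|r rP] := @linear_of_rel _ E K (fun e k => i k = s (h (b e))).
- by move=> e; apply/fk; rewrite fs hE ub.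
- by move=> e k k' <- /iinj.
- by rewrite !linearP ik ik'.
apply: (section_of_retraction qs qk (r := r)) => k.
by apply: iinj; rewrite rP ab; apply: sK.
Qed.

(** For a module [X] in the left orthogonal, Wakamatsu's lemma makes its flat cover split, so that
    [X] is a direct summand of a flat module. *)
Lemma flat_cotorsion_pair : cotorsion_pair fam_flat (perp_right fam_flat).
Proof.
split=> // X; split=> [Xf Y|Xp]; first by apply.
have [P [f fc]] := flat_covering X; have fs := flat_cover_surj fc.
have hK : submod (fun x => f x = 0).
  split; first exact: linear0.
  by move=> a x y fx fy; rewrite linearP fx fy scaler0 addr0.
have [K [i [iinj iE]]] := submodule_module hK.
have [s sE] := Xp K (flat_cover_kernel fc iinj iE) P i f iinj fs iE.
move=> k0 k1 k2 r0 r1 fr x hx; have [Pf _ _] := fc.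
have [j|y hy] := Pf _ _ _ _ _ fr (fun l => s (x l)); first by rewrite -(act_linear s) hx linear0.
exists (fun l => f (y l)) => l.
by rewrite -(act_linear f) -{1}[x l]sE -linearB hy linear0.
Qed.

Lemma flat_perp_enveloping : enveloping (perp_right fam_flat).
Proof.
move=> N; pose M : lmodType R := 'rV[R]_0.
have M0 (m m' : M) : m = m' by rewrite (thinmx0 m) (thinmx0 m').
have [G [Gt Ge]] := terminal_obj fam N M.
have [C [c [cs ck]]] := quotient_module (submod_im (oi G)).
have Cf : fam_flat C by apply/(rflat_quotient cs ck); apply: ob_flat.
exists G, (oi G); split.
(* An extension [E] of a flat module by [G] is again an object, so it maps to [G]; the composite
   [G -> E -> G] is an automorphism, which splits the extension. *)
- move=> D Df E j q jinj qs qk.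
  have iinj : injective (j \o oi G) by move=> x y /jinj/oi_inj.
  have Ef : rflat fam (im (j \o oi G)).
    apply: rflat_iff (flat_extension jinj qs qk (@ob_flat _ _ _ _ G) Df) => e.
    by split=> [[_ [n <-] <-]|[n <-]]; [exists n|exists (oi G n) => //; exists n].
  have [h [hi _]] := Gt (Obj iinj (fun n => M0 ((\0 : {linear E -> M}) _) 0) Ef).
  have hj : mor (h \o j) by split=> [n|x]; [exact: (hi n)|exact: M0].
  have [s [sK _]] := linear_bij_inv (Ge _ hj).
  exact: (section_of_retraction qs qk (r := s \o h) sK).
(* The pushout along [g] is an extension of the flat module [C] by [Y], so it splits, and a
   retraction onto [Y] extends [g] to [G]. *)
- move=> Y Yp g.
  have [W [a [b [ab Ws Wk Wu]]]] := pushout (oi G) g.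
  have [|v [va vb]] := Wu _ \0 c; first by move=> n /=; apply/ck; exists n.
  have ainj : injective a.
    apply: linear_inj => y ay; have [|n [-> /esym]] := Wk y 0; first by rewrite ay linear0 addr0.
    by rewrite -[RHS](linear0 (oi G)) => /oi_inj ->; rewrite linear0 oppr0.
  have vs : surj v by move=> z; have [x <-] := cs z; exists (b x).
  have vk w : v w = 0 <-> im a w.
    split=> [|[x <-]]; last by rewrite va.
    have [y [x ->]] := Ws w; rewrite linearD va vb add0r => /ck [n <-].
    by exists (y + g n); rewrite linearD ab.
  have [s sP] := Yp _ Cf W a v ainj vs vk.
  have [r rK] := retraction_of_section ainj vk sP.
  by exists (r \o b) => n; rewrite /= ab rK.
- by move=> g gi; apply: Ge; split=> // x; apply: M0.
Qed.

Theorem perfect_flat : perfect_cotorsion_pair fam_flat (perp_right fam_flat).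
Proof.
split; [exact: flat_cotorsion_pair|exact: flat_covering|exact: flat_perp_enveloping].
Qed.

End Perfect.

(** * Coefficient matrices of resolutions of modules in FP_n *)

Section FPnFamily.
Variables (R : pzRingType) (n : nat).

Definition coefs a b (f : {linear 'rV[R^c]_a -> 'rV[R^c]_b}) : 'I_b -> 'I_a -> R :=
  fun j i => f (delta_mx 0 i) 0 j.

Definition FPn_fam k0 k1 k2 (r0 : 'I_k0 -> 'I_k1 -> R) (r1 : 'I_k1 -> 'I_k2 -> R) : Prop :=
  exists (F : lmodType R^c) (e : {linear 'rV[R^c]_k0 -> F})
    (d0 : {linear 'rV[R^c]_k1 -> 'rV[R^c]_k0}) (d1 : {linear 'rV[R^c]_k2 -> 'rV[R^c]_k1}),
  [/\ FPn n F, surj e, forall x, e x = 0 <-> im d0 x, forall x, d0 x = 0 <-> im d1 x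
    & r0 = coefs d0 /\ r1 = coefs d1].

Lemma FPn_flatE : FPn_flat (R := R) n = fam_flat FPn_fam.
Proof.
apply/funext => X; apply/propext; split=> [h k0 k1 k2 r0 r1|h F Fn k0 k1 k2 e d0 d1 es ek dk x hx].
  move=> [F [e [d0 [d1 [Fn es ek dk [-> ->]]]]]] x hx.
  have [y hy] := h F Fn _ _ _ e d0 d1 es ek dk x hx.
  by exists y => i; rewrite -hy subrr.
have [|y hy] := h _ _ _ (coefs d0) (coefs d1) _ x hx; first by exists F, e, d0, d1.
by exists y => i; apply/esym/eqP; rewrite -subr_eq0; apply/eqP; apply: hy.
Qed.

(** Scalars of [R^c] multiply on the right in [R], so a linear map is left multiplication by its
    coefficients. *)
Lemma coefsE a b (f : {linear 'rV[R^c]_a -> 'rV[R^c]_b}) (x : 'rV[R^c]_a) j :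
  f x 0 j = \sum_i coefs f j i * (x 0 i : R).
Proof.
rewrite {1}[x]row_sum_delta linear_sum summxE; apply: eq_bigr => i _.
by rewrite linearZ mxE.
Qed.

Lemma FPn_fam_comp0 k0 k1 k2 (r0 : 'I_k0 -> 'I_k1 -> R) (r1 : 'I_k1 -> 'I_k2 -> R) :
  FPn_fam r0 r1 -> forall j l, \sum_i r0 j i * r1 i l = 0.
Proof.
move=> [F [e [d0 [d1 [_ _ _ dk [-> ->]]]]]] j l.
have : d0 (d1 (delta_mx 0 l)) = 0 by apply/dk; exists (delta_mx 0 l).
by move=> /(congr1 (fun m : 'rV[R^c]_k0 => m 0 j)); rewrite coefsE mxE.
Qed.

(** Tensoring with the regular module gives back the resolution, which is exact at its middle
    term. *)
Lemma FPn_fam_regular : fam_flat FPn_fam R^o.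
Proof.
move=> k0 k1 k2 r0 r1 [F [e [d0 [d1 [_ _ _ dk [-> ->]]]]]] x hx.
have /dk [y hy] : d0 (\row_i (x i : R^c)) = 0.
  apply/rowP => j; rewrite coefsE mxE -[RHS](hx j).
  by apply: eq_bigr => i _; rewrite mxE.
exists (fun l => y 0 l) => i.
have /= := congr1 (fun m : 'rV[R^c]_k1 => m 0 i) hy.
by rewrite coefsE mxE => <-; apply: subrr.
Qed.

End FPnFamily.

Theorem theorem4p5 (R : pzRingType) (n : nat) :
  (1 < n)%N ->
  perfect_cotorsion_pair (FPn_flat (R:=R) n) (perp_right (FPn_flat (R:=R) n)).
Proof.
move=> _; rewrite FPn_flatE.
apply: perfect_flat; [exact: FPn_fam_comp0|exact: FPn_fam_regular].
Qed.
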